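(* Let $\Omega\subset\mathbb{R}^d$ be bounded, nonempty and open, let $f\in L^2(\Omega)$, let $\gamma:\mathbb{R}^d\times\mathbb{R}^d\to[0,\infty)$ be measurable and symmetric, and let the measurable function $g:\Gamma\to\mathbb{R}$ satisfy the continuous functional condition. Then the nonhomogeneous nonlocal Neumann problem $$\mathcal{L}u=f\ \text{ on }\Omega,\qquad \mathcal{N}u=g\ \text{ on }\Gamma,$$ has a weak solution if $$\int_\Omega f(x)\,dx+\int_\Gamma g(y)\,dy=0$$ and if there is a constant $C>0$ such that for all $v\in\mathrm{V}(\Omega;\gamma)$ $$\int_\Omega\int_\Omega(v(x)-v(y))^2\,dy\,dx\le C\int_\Omega\int_{\mathbb{R}^d}(v(x)-v(y))^2\gamma(y,x)\,dy\,dx.$$ Furthermore, the weak solution is unique up to an additive constant.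
   Context: Measurability is with respect to Lebesgue measure; symmetric means $\gamma(x,y)=\gamma(y,x)$. Let $\Gamma:=\{y\in\mathbb{R}^d\setminus\Omega:\int_\Omega\gamma(y,x)\,dx>0\}$. $\mathrm{V}(\Omega;\gamma)$ is the space of measurable $v:\mathbb{R}^d\to\mathbb{R}$ with $$\|v\|_{\mathrm{V}(\Omega;\gamma)}^2:=\int_\Omega v^2(x)\,dx+\int_\Omega\int_{\mathbb{R}^d}(v(x)-v(y))^2\gamma(y,x)\,dy\,dx<\infty,$$ functions agreeing a.e. on $\Omega\cup\Gamma$ being identified. On it let $$\mathfrak{B}(u,v):=\tfrac12\int_\Omega\int_\Omega(u(x)-u(y))(v(x)-v(y))\gamma(y,x)\,dy\,dx+\int_\Omega\int_\Gamma(u(x)-u(y))(v(x)-v(y))\gamma(y,x)\,dy\,dx.$$ A measurable $g:\Gamma\to\mathbb{R}$ satisfies the continuous functional condition if $v\mapsto\int_\Gamma g(y)v(y)\,dy$ is a (well-defined) continuous linear functional on $\mathrm{V}(\Omega;\gamma)$. Here $\mathcal{L}u(x)=\int_{\mathbb{R}^d}(u(x)-u(y))\gamma(y,x)\,dy$ and $\mathcal{N}u(y)=\int_\Omega(u(y)-u(x))\gamma(y,x)\,dx$. A weak solution of $\mathcal{L}u=f$ on $\Omega$, $\mathcal{N}u=g$ on $\Gamma$ is a function $u\in\mathrm{V}(\Omega;\gamma)$ with $$\int_\Omega f(x)v(x)\,dx+\int_\Gamma g(y)v(y)\,dy=\mathfrak{B}(u,v)\quad\text{for all }v\in\mathrm{V}(\Omega;\gamma).$$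 *)

(* Defs.v *)
From HB Require Import structures.
From mathcomp Require Import all_boot all_order all_algebra.
From mathcomp Require Import all_classical all_reals all_analysis.
Set Implicit Arguments.
Unset Strict Implicit.
Unset Printing Implicit Defensive.
Import Order.TTheory GRing.Theory Num.Theory.
Import numFieldNormedType.Exports.
Local Open Scope classical_set_scope.
Local Open Scope ring_scope.

(* The pair p encodes the closed box with lower corner p.1 and upper corner
   p.2; it is empty, with volume 0, as soon as p.2 0 i < p.1 0 i for some i. *)
Definition box (R : realType) (n : nat) (p : 'rV[R]_n * 'rV[R]_n) :
    set 'rV[R]_n :=
  [set x | forall i, p.1 0 i <= x 0 i <= p.2 0 i].

Definition box_vol (R : realType) (n : nat) (p : 'rV[R]_n * 'rV[R]_n) : R :=
  \prod_(i < n) Num.max 0 (p.2 0 i - p.1 0 i).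

Definition lebesgue_outer (R : realType) (n : nat) (A : set 'rV[R]_n) : \bar R :=
  ereal_inf [set \esum_(p in D) (box_vol p)%:E |
    D in [set D | countable D /\ A `<=` \bigcup_(p in D) box p]].

Section lebesgue_outer_theory.
Context (R : realType) (n : nat).
Local Open Scope ereal_scope.
Local Notation mu := (@lebesgue_outer R n).

Lemma box_vol_ge0 (p : 'rV[R]_n * 'rV[R]_n) : 0 <= (box_vol p)%:E.
Proof. by rewrite lee_fin prodr_ge0// => i _; rewrite le_max lexx. Qed.

Lemma lebesgue_outer_ge0 (A : set 'rV[R]_n) : 0 <= mu A.
Proof.
apply: le_ereal_inf_tmp => _ [D _ <-]; apply: esum_ge0 => p _.
exact: box_vol_ge0.
Qed.

Lemma lebesgue_outer0 : mu set0 = 0.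
Proof.
apply/eqP; rewrite eq_le lebesgue_outer_ge0 andbT.
apply: ereal_inf_lbound; exists set0; last by rewrite esum_set0.
by split; [exact: countable0|exact: sub0set].
Qed.

Lemma le_lebesgue_outer : {homo mu : A B / A `<=` B >-> A <= B}.
Proof.
move=> A B AB; apply/ereal_inf_le_tmp => _ [D [cD BD] <-].
by exists D => //; split=> //; exact: subset_trans BD.
Qed.

Lemma lebesgue_outer_sigma_subadditive : sigma_subadditive mu.
Proof.
move=> A; have [[i ioo]|] := pselect (exists i, mu (A i) = +oo).
  rewrite (eseries_pinfty _ _ ioo) ?leey// => k _.
  by rewrite -ltNye (lt_le_trans _ (lebesgue_outer_ge0 _)).
rewrite -forallNE => Aoo.
apply/lee_addgt0Pr => e e0.
rewrite (le_trans _ (epsilon_trick _ _ _))//; last 2 first.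
- by move=> k; exact: lebesgue_outer_ge0.
- exact: ltW.
have /choice[D HD] : forall k, exists D : set ('rV[R]_n * 'rV[R]_n),
    [/\ countable D, A k `<=` \bigcup_(p in D) box p &
    \esum_(p in D) (box_vol p)%:E <= mu (A k) + (e / (2 ^ k.+1)%:R)%:E].
  move=> k; have fA : mu (A k) \is a fin_num.
    by rewrite ge0_fin_numE ?lebesgue_outer_ge0// ltey; apply/eqP.
  have ek : (0 < e / (2 ^ k.+1)%:R)%R by rewrite divr_gt0// ltr0n expn_gt0.
  have [_ [D [cD AD] <-] /ltW Dle] := lb_ereal_inf_adherent ek fA.
  by exists D.
have cU : countable (\bigcup_k D k).
  by apply: bigcup_countable => // k _; have [] := HD k.
apply: (@le_trans _ _ (\esum_(p in \bigcup_k D k) (box_vol p)%:E)).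
  apply: ereal_inf_lbound; exists (\bigcup_k D k) => //; split => // x [k _].
  have [_ + _] := HD k => /[apply] -[p Dp px].
  by exists p => //; exists k.
have /choice[f Hf] : forall p, exists k, (\bigcup_k D k) p -> D k p.
  move=> p; have [[k _ Dkp]|nU] := pselect ((\bigcup_k D k) p).
    by exists k.
  by exists 0%N => /nU.
apply: (@le_trans _ _ (\sum_(k <oo) \esum_(p in D k) (box_vol p)%:E)); last first.
  apply: lee_nneseries => k _; last by have [] := HD k.
  by move=> _; apply: esum_ge0 => p _; exact: box_vol_ge0.
rewrite nneseries_esumT; last first.
  by move=> k; apply: esum_ge0 => p _; exact: box_vol_ge0.
rewrite esum_esum; last by move=> *; exact: box_vol_ge0.
have inj : set_inj (\bigcup_k D k) (fun p => (f p, p)).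
  by move=> p q _ _ [].
rewrite -(@esum_image R _ _ _ _
  (fun z : nat * ('rV[R]_n * 'rV[R]_n) => (box_vol z.2)%:E) inj).
apply: ge_ereal_sup => _ [X [finX XI] <-].
apply: esum_ge; exists X => //; split => // z /XI[p Up <-].
by split => //=; exact: Hf.
Qed.

HB.instance Definition _ := isOuterMeasure.Build R 'rV[R]_n mu
  lebesgue_outer0 lebesgue_outer_ge0 le_lebesgue_outer
  lebesgue_outer_sigma_subadditive.

End lebesgue_outer_theory.

(* R^n with the sigma-algebra of Lebesgue (that is, Caratheodory) measurable
   sets *)
Notation lebesgue_space R n := (caratheodory_type (@lebesgue_outer R n)).

Definition lebesgue_rV (R : realType) (n : nat) :
    set (lebesgue_space R n) -> \bar R := @lebesgue_outer R n.

HB.instance Definition _ (R : realType) (n : nat) :=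
  isMeasure.Build _ (lebesgue_space R n) R (@lebesgue_rV R n)
    (@caratheodory_measure0 R 'rV[R]_n (@lebesgue_outer R n))
    (@caratheodory_measure_ge0 R 'rV[R]_n (@lebesgue_outer R n))
    (@caratheodory_measure_sigma_additive R 'rV[R]_n (@lebesgue_outer R n)).

Arguments lebesgue_rV : clear implicits.

Definition rV_measurable_fun (R : realType) (n : nat) (D : set 'rV[R]_n)
    (h : 'rV[R]_n -> R) : Prop :=
  measurable_fun (D : set (lebesgue_space R n)) (h : lebesgue_space R n -> R).

Definition square_integrable (R : realType) (n : nat) (D : set 'rV[R]_n)
    (f : 'rV[R]_n -> R) : Prop :=
  rV_measurable_fun D f /\ (\int[lebesgue_rV R n]_(x in D) (f x ^+ 2)%:E < +oo)%E.

(* joint measurability on R^d x R^d, identified with R^(d + d) by concatenating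
   coordinates *)
Definition jointly_measurable (R : realType) (d : nat)
    (gamma : 'rV[R]_d -> 'rV[R]_d -> R) : Prop :=
  @rV_measurable_fun R (d + d) setT (fun z => gamma (lsubmx z) (rsubmx z)).

Definition symmetric_kernel (R : realType) (d : nat)
    (gamma : 'rV[R]_d -> 'rV[R]_d -> R) : Prop :=
  forall x y, gamma x y = gamma y x.

Definition interaction_domain (R : realType) (d : nat) (Omega : set 'rV[R]_d)
    (gamma : 'rV[R]_d -> 'rV[R]_d -> R) : set 'rV[R]_d :=
  [set y | ~ Omega y /\ (0 < \int[lebesgue_rV R d]_(x in Omega) (gamma y x)%:E)%E].

Definition energy (R : realType) (d : nat) (Omega : set 'rV[R]_d)
    (gamma : 'rV[R]_d -> 'rV[R]_d -> R) (v : 'rV[R]_d -> R) : \bar R :=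
  (\int[lebesgue_rV R d]_(x in Omega) \int[lebesgue_rV R d]_y
     ((v x - v y) ^+ 2 * gamma y x)%:E)%E.

Definition normV_sqr (R : realType) (d : nat) (Omega : set 'rV[R]_d)
    (gamma : 'rV[R]_d -> 'rV[R]_d -> R) (v : 'rV[R]_d -> R) : \bar R :=
  (\int[lebesgue_rV R d]_(x in Omega) (v x ^+ 2)%:E + energy Omega gamma v)%E.

(* The elements of V(Omega; gamma) are handled through representatives; the
   identification of functions that agree almost everywhere on
   Omega `|` interaction_domain Omega gamma is [eqV]. *)
Definition inV (R : realType) (d : nat) (Omega : set 'rV[R]_d)
    (gamma : 'rV[R]_d -> 'rV[R]_d -> R) (v : 'rV[R]_d -> R) : Prop :=
  rV_measurable_fun setT v /\ (normV_sqr Omega gamma v < +oo)%E.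

Definition eqV (R : realType) (d : nat) (Omega : set 'rV[R]_d)
    (gamma : 'rV[R]_d -> 'rV[R]_d -> R) (u v : 'rV[R]_d -> R) : Prop :=
  {ae lebesgue_rV R d, forall x,
    (Omega `|` interaction_domain Omega gamma) x -> u x = v x}.

Definition normV (R : realType) (d : nat) (Omega : set 'rV[R]_d)
    (gamma : 'rV[R]_d -> 'rV[R]_d -> R) (v : 'rV[R]_d -> R) : R :=
  Num.sqrt (fine (normV_sqr Omega gamma v)).

Definition bilinV (R : realType) (d : nat) (Omega : set 'rV[R]_d)
    (gamma : 'rV[R]_d -> 'rV[R]_d -> R) (u v : 'rV[R]_d -> R) : \bar R :=
  ((2^-1)%:E * (\int[lebesgue_rV R d]_(x in Omega) \int[lebesgue_rV R d]_(y in Omega)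
      ((u x - u y) * (v x - v y) * gamma y x)%:E)
   + \int[lebesgue_rV R d]_(x in Omega)
       \int[lebesgue_rV R d]_(y in interaction_domain Omega gamma)
         ((u x - u y) * (v x - v y) * gamma y x)%:E)%E.

Definition continuous_linear_functionalV (R : realType) (d : nat)
    (Omega : set 'rV[R]_d) (gamma : 'rV[R]_d -> 'rV[R]_d -> R)
    (F : ('rV[R]_d -> R) -> R) : Prop :=
  [/\ forall u v, inV Omega gamma u -> inV Omega gamma v ->
        eqV Omega gamma u v -> F u = F v,
      forall (a : R) u v, inV Omega gamma u -> inV Omega gamma v ->
        F (fun x => a * u x + v x) = a * F u + F v &
      forall v, inV Omega gamma v -> forall e, 0 < e ->
        exists2 r, 0 < r & forall w, inV Omega gamma w ->
          normV Omega gamma (fun x => w x - v x) < r -> `|F w - F v| < e].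

Definition continuous_functional_condition (R : realType) (d : nat)
    (Omega : set 'rV[R]_d) (gamma : 'rV[R]_d -> 'rV[R]_d -> R)
    (g : 'rV[R]_d -> R) : Prop :=
  let Gamma := interaction_domain Omega gamma in
  [/\ rV_measurable_fun Gamma g,
      forall v, inV Omega gamma v ->
        (lebesgue_rV R d).-integrable Gamma (fun y => (g y * v y)%:E) &
      continuous_linear_functionalV Omega gamma
        (fun v => \int[lebesgue_rV R d]_(y in Gamma) (g y * v y))].

Definition weak_neumann_solution (R : realType) (d : nat)
    (Omega : set 'rV[R]_d) (gamma : 'rV[R]_d -> 'rV[R]_d -> R)
    (f g u : 'rV[R]_d -> R) : Prop :=
  inV Omega gamma u /\
  forall v, inV Omega gamma v ->
    (\int[lebesgue_rV R d]_(x in Omega) (f x * v x)%:E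
     + \int[lebesgue_rV R d]_(y in interaction_domain Omega gamma) (g y * v y)%:E)%E
    = bilinV Omega gamma u v.

(* Main.v *)
Require Import Defs.
From HB Require Import structures.
From mathcomp Require Import all_boot all_order all_algebra.
From mathcomp Require Import all_classical all_reals all_analysis.
From mathcomp Require Import measurable_realfun ring lra.
Import Order.TTheory GRing.Theory Num.Theory.
Import numFieldNormedType.Exports.
Local Open Scope classical_set_scope.
Local Open Scope ring_scope.

Set Implicit Arguments.
Unset Strict Implicit.
Unset Printing Implicit Defensive.

(* The form B is a single integral of (u(x)-u(y))(v(x)-v(y)) against a kernel k
   on Omega x (Omega u Gamma), and B(v,v) <= energy <= 2 B(v,v) because gamma
   vanishes almost everywhere from Omega to the complement of Omega u Gamma.  By
   the Poincare inequality, after subtraction of a constant the norm of V is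
   controlled by B; as the load F(v) = int f v + int g v kills constants, F is
   bounded for the seminorm of B.  The solution is the Riesz representative of
   F, obtained by minimising B(v,v) - 2 F(v), provided that V is complete for B.
   For completeness take v_n with B(v_{n+1}-v_n) <= 4^-n and subtract constants
   so that the increments a_n are also small in L2(Omega).  Then
   sum 2^n a_n(x)^2 is finite for almost every x in Omega, and
   sum 2^n (a_n(x)-a_n(y))^2 is finite for almost every (x,y) with k(x,y) > 0;
   since almost every y in Gamma has k(x,y) > 0 for a set of x of positive
   measure, the series sum a_n(y) converges there too.  The same transfer from
   Omega to Gamma shows that B(w,w) = 0 forces w to be constant. *)

(** * Riesz representation for a complete semi-inner product *)

(** The main obstacle is measurability: [gamma] is Lebesgue measurable on R^(d+d), whereas Tonelli
    and Fubini are available for product-measurable functions. Box covers show that a Lebesgue null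
    set of R^(d+d) pulls back into a product-measurable null set, so some product-measurable [k0]
    agrees with [gamma] on almost every section; completeness of Lebesgue measure on R^d then lets
    [k0] replace [gamma] inside iterated integrals. Elements of V are functions, not classes, and B
    is only semidefinite, so the Riesz argument is run for a semi-inner product on a set of
    functions. Completeness is obtained pointwise because the norm of V contains no L2 norm on
    Gamma: values at y in Gamma are reached only through jumps from points x of Omega. This fixes
    the rates. Against increments of energy 4^-n the weight 2^n leaves 2^-n, which is summable,
    while Cauchy-Schwarz with the dual weights 2^-k, whose sum over k >= n is 2 * 2^-n, turns a
    finite weighted sum into pointwise convergence with an explicit tail. *)

Lemma discriminant_le (R : realFieldType) (p q r : R) : 0 <= p ->
  (forall t, 0 <= t ^+ 2 * p + t * q *+ 2 + r) -> q ^+ 2 <= p * r.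
Proof.
move=> p0 H; have [p_eq0|pN0] := eqVneq p 0.
  suff -> : q = 0 by rewrite p_eq0 expr0n mul0r.
  apply/eqP/negPn/negP => q0.
  (* With p = 0 the polynomial is affine in t; this t gives it the value -1. *)
  have := H (- (r + 1) / (q *+ 2)).
  suff -> : (- (r + 1) / (q *+ 2)) ^+ 2 * p + - (r + 1) / (q *+ 2) * q *+ 2 + r
    = -1 by rewrite oppr_ge0 ler10.
  by rewrite p_eq0; field.
have {}p0 : 0 < p by rewrite lt_neqAle eq_sym pN0.
have := H (- q / p).
have -> : (- q / p) ^+ 2 * p + - q / p * q *+ 2 + r = (p * r - q ^+ 2) / p.
  by field.
by rewrite pmulr_lge0 ?invr_gt0// subr_ge0.
Qed.

Section riesz.
Context (R : realType) (E : lmodType R) (V : set E) (b : E -> E -> R).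
Hypothesis V0 : V 0.
Hypothesis VD : forall a u v, V u -> V v -> V (a *: u + v).
Hypothesis bC : forall u v, V u -> V v -> b u v = b v u.
Hypothesis bD : forall a u v w, V u -> V v -> V w ->
  b (a *: u + v) w = a * b u w + b v w.
Hypothesis b_ge0 : forall u, V u -> 0 <= b u u.

Let VZ a u : V u -> V (a *: u).
Proof. by move=> Vu; rewrite -[_ *: _]addr0; exact: VD. Qed.

Let VB u v : V u -> V v -> V (u - v).
Proof. by move=> Vu Vv; rewrite addrC -scaleN1r; exact: VD. Qed.

Let b_sqr a u v : V u -> V v ->
  b (a *: u + v) (a *: u + v) = a ^+ 2 * b u u + a * b u v *+ 2 + b v v.
Proof.
move=> Vu Vv; rewrite bD//; last exact: VD.
rewrite (bC Vu) ?(bC Vv); [|exact: VD..].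
by rewrite !bD// (bC Vv Vu); ring.
Qed.

Lemma semi_inner_cauchy_schwarz u v : V u -> V v ->
  b u v ^+ 2 <= b u u * b v v.
Proof.
move=> Vu Vv; apply: discriminant_le => [|t]; first exact: b_ge0.
by rewrite -b_sqr//; apply: b_ge0; exact: VD.
Qed.

Variables (F : E -> R) (C : R).
Hypothesis FD : forall a u v, V u -> V v -> F (a *: u + v) = a * F u + F v.
Hypothesis C_gt0 : 0 < C.
Hypothesis F_bounded : forall u, V u -> F u ^+ 2 <= C * b u u.
(** Only sequences with geometrically small increments are asked to converge; the minimising
    sequence is chosen to have this rate, so no subsequence is extracted. *)
Hypothesis complete : forall v : nat -> E, (forall n, V (v n)) ->
  (forall n, b (v n.+1 - v n) (v n.+1 - v n) <= (4^-1) ^+ n) ->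
  exists2 u, V u & forall e, 0 < e ->
    \forall n \near \oo, b (v n - u) (v n - u) < e.

Let J u := b u u - F u *+ 2.

Let J_sqr a u v : V u -> V v ->
  J (a *: u + v) = a ^+ 2 * b u u + a * (b u v - F u) *+ 2 + J v.
Proof. by move=> Vu Vv; rewrite /J b_sqr// FD//; ring. Qed.

Let J_lbound u : V u -> - C <= J u.
Proof.
move=> Vu; rewrite /J; have := F_bounded Vu; rewrite expr2 => FC.
(* By the bound on [F u ^+ 2], this product is at least (F u - C)^2. *)
suff : 0 <= C * (b u u - F u *+ 2 + C).
  by rewrite pmulr_rge0//; lra.
by have := sqr_ge0 (F u - C); rewrite expr2; lra.
Qed.

Lemma semi_inner_riesz : exists2 u, V u & forall w, V w -> b u w = F w.
Proof.
pose S := [set J u | u in V].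
have S_inf : has_inf S.
  split; first by exists (J 0), 0.
  by exists (- C) => _ [u Vu <-]; exact: J_lbound.
pose m := inf S.
have m_le u : V u -> m <= J u.
  by move=> Vu; apply: ge_inf; [case: S_inf|exists u].
(* The shift by one absorbs the constant of the parallelogram identity: 2 (eps n + eps (n+1)) = 5/8
   * 4^-n. *)
pose eps n : R := (4^-1) ^+ n.+1.
have eps_gt0 n : 0 < eps n by rewrite exprn_gt0.
have /choice[v Hv] : forall n, exists u, V u /\ J u <= m + eps n.
  move=> n; have [_ [u Vu <-] uM] := inf_adherent (eps_gt0 n) S_inf.
  by exists u; split => //; exact: ltW.
have Vv n : V (v n) by have [] := Hv n.
have Jv n : J (v n) <= m + eps n by have [] := Hv n.
have dv n : b (v n.+1 - v n) (v n.+1 - v n) <= (4^-1) ^+ n.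
  have -> : v n.+1 - v n = (-1) *: v n + v n.+1 by rewrite scaleN1r addrC.
  rewrite b_sqr//.
  (* Parallelogram identity: [J] at the midpoint of [v n] and [v n.+1] is the mean of the two values
     minus a quarter of the energy of the difference, and it is at least m. *)
  have := m_le _ (VD 2^-1 (Vv n) (VZ 2^-1 (Vv n.+1))).
  rewrite J_sqr//; last exact: VZ.
  rewrite -[2^-1 *: v n.+1]addr0 J_sqr// addr0 (bC (Vv n) (VZ _ (Vv _))).
  rewrite -[2^-1 *: v n.+1]addr0 bD// /J.
  have b0 w : V w -> b 0 w = 0.
    move=> Vw; have := bD 1 V0 V0 Vw.
    by rewrite scaler0 addr0 mul1r; lra.
  have F0 : F 0 = 0.
    by have := FD 1 V0 V0; rewrite scaler0 addr0 mul1r; lra.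
  rewrite (bC (Vv n.+1) V0) !b0// F0 (bC (Vv n.+1) (Vv n)).
  have := Jv n; have := Jv n.+1; rewrite /J /eps !exprS.
  have : 0 < (4^-1 : R) ^+ n by rewrite exprn_gt0.
  lra.
have [u Vu Hu] := complete Vv dv.
exists u => // w Vw; apply/eqP; rewrite -subr_eq0 -sqrf_eq0 eq_le sqr_ge0 andbT.
apply/ler_addgt0Pr => e e0; rewrite add0r.
(* The error b u w - F w is the difference of two terms whose squares are at most b w w * s each, so
   its square is at most 4 * b w w * s. The added 1 allows b w w = 0. *)
pose s := e / (4 * (b w w + 1)).
have bw := b_ge0 Vw.
have s0 : 0 < s by rewrite divr_gt0// mulr_gt0// ltr_pwDr.
have [n [eps_s bn]] : exists n, eps n < s /\ b (v n - u) (v n - u) < s.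
  have eps_cvg : eps @ \oo --> 0.
    rewrite /eps; rewrite (cvg_shiftS (fun n => (4^-1 : R) ^+ n)).
    by apply: cvg_expr; rewrite gtr0_norm ?invf_lt1// ltr1n.
  near \oo => n; exists n; split; last by near: n; exact: Hu.
  by near: n; exact: (cvgr_lt _ eps_cvg).
(* A near-minimiser nearly solves the equation: J (t w + v n) - m is a nonnegative quadratic in t
   whose constant term is at most [eps n]. *)
have near_min : (b (v n) w - F w) ^+ 2 <= b w w * eps n.
  apply: discriminant_le => // t.
  have := m_le _ (VD t Vw (Vv n)); rewrite J_sqr// (bC Vw)//.
  by have := Jv n; lra.
have cs : b (v n - u) w ^+ 2 <= b (v n - u) (v n - u) * b w w.
  by apply: semi_inner_cauchy_schwarz => //; exact: VB.
have bB : b (v n - u) w = b (v n) w - b u w.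
  have -> : v n - u = (-1) *: u + v n by rewrite scaleN1r addrC.
  by rewrite bD//; ring.
have es : b w w * s *+ 4 <= e.
  have -> : e = s * (4 * (b w w + 1)).
    rewrite /s divfK// mulf_neq0// ?gt_eqF//.
    by rewrite ltr_pwDr.
  by lra.
apply: (@le_trans _ _ ((b (v n) w - F w) ^+ 2 *+ 2 + b (v n - u) w ^+ 2 *+ 2)).
  have := sqr_ge0 ((b (v n) w - F w) + b (v n - u) w).
  by rewrite bB !expr2; lra.
have h1 : b w w * eps n <= b w w * s by rewrite ler_wpM2l// ltW.
have h2 : b (v n - u) (v n - u) * b w w <= b w w * s.
  by rewrite mulrC ler_wpM2l// ltW.
lra.
Unshelve. all: by end_near. Qed.

End riesz.

(** * Dyadically weighted square-summable series *)

(** Cauchy-Schwarz for two terms: the cross term is bounded through 4 (p a)(q b) <= (p b + q a)^2.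
    Taking inequalities as hypotheses makes it the induction step of a finite sum. *)
Lemma sqrrD_le (R : realFieldType) (p q x y a b : R) : 0 <= p -> 0 <= q ->
  x ^+ 2 <= p * a -> y ^+ 2 <= q * b -> 0 <= a -> 0 <= b ->
  (x + y) ^+ 2 <= (p + q) * (a + b).
Proof.
move=> p0 q0 xpa yqb a0 b0.
suff : x * y *+ 2 <= p * b + q * a by rewrite sqrrD; lra.
have pbqa0 : 0 <= p * b + q * a by rewrite addr_ge0// mulr_ge0.
rewrite (le_trans (ler_norm _))// -ler_sqr ?nnegrE// real_normK ?num_real//.
have : x ^+ 2 * y ^+ 2 <= (p * a) * (q * b) by rewrite ler_pM// sqr_ge0.
have := sqr_ge0 (p * b - q * a).
rewrite !expr2 => h1 h2; lra.
Qed.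

(** Cauchy-Schwarz with weights 2^k and 2^-k; the first factor on the right is the exact sum of 2^-k
    over the range. *)
Lemma dyadic_sum_sqr_le (R : realFieldType) (a : nat -> R) (n j : nat) :
  (\sum_(n <= k < n + j) a k) ^+ 2 <=
  2 * (2^-1 ^+ n - 2^-1 ^+ (n + j)) * \sum_(n <= k < n + j) 2 ^+ k * a k ^+ 2.
Proof.
elim: j => [|j IH]; first by rewrite addn0 !big_geq// mulr0 expr0n.
rewrite addnS !big_nat_recr/= ?leq_addr//.
have e2 : (2^-1 : R) ^+ n - 2^-1 ^+ (n + j) >= 0.
  rewrite subr_ge0 ler_wiXn2l ?leq_addr// ?invf_le1 ?ler1n//.
apply: le_trans (sqrrD_le _ _ IH (q := 2^-1 ^+ (n + j))
   (b := 2 ^+ (n + j) * a (n + j)%N ^+ 2) _ _ _) _.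
- by rewrite mulr_ge0.
- by rewrite exprn_ge0.
- by rewrite mulrA -exprMn mulVf// expr1n mul1r.
- by rewrite sumr_ge0// => i _; rewrite mulr_ge0 ?sqr_ge0// exprn_ge0.
- by rewrite mulr_ge0 ?sqr_ge0// exprn_ge0.
apply: ler_wpM2r.
  rewrite addr_ge0//; last by rewrite mulr_ge0 ?sqr_ge0// exprn_ge0.
  by rewrite sumr_ge0// => i _; rewrite mulr_ge0 ?sqr_ge0// exprn_ge0.
by rewrite exprS; lra.
Qed.

Lemma dyadic_series_cvg (R : realType) (a : R^nat) (s : R) :
  (forall n, \sum_(0 <= k < n) 2 ^+ k * a k ^+ 2 <= s) ->
  exists2 l, series a @ \oo --> l &
    forall n, (l - series a n) ^+ 2 <= 2 * 2^-1 ^+ n * s.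
Proof.
move=> as_; have term_ge0 k : 0 <= 2 ^+ k * a k ^+ 2.
  by rewrite mulr_ge0 ?sqr_ge0// exprn_ge0.
have inc n m : (n <= m)%N ->
    (series a m - series a n) ^+ 2 <= 2 * 2^-1 ^+ n * s.
  move=> nm; rewrite sub_series_geq// -(subnKC nm).
  apply: (le_trans (dyadic_sum_sqr_le _ _ _)).
  apply: ler_pM.
  - rewrite mulr_ge0// subr_ge0 ler_wiXn2l ?leq_addr ?invr_ge0//.
    by rewrite invf_le1// ler1n.
  - by rewrite sumr_ge0.
  - by rewrite ler_wpM2l// gerBl exprn_ge0.
  - rewrite (le_trans _ (as_ (n + (m - n))%N))//.
    by rewrite [leRHS](@big_cat_nat _ _ _ n)//= ?leq_addr// lerDr sumr_ge0.
have normedE n : [normed series a] n = \sum_(0 <= k < n) `|a k| by [].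
have acvg : cvgn (series a).
  apply: normed_cvg; apply: nondecreasing_is_cvgn.
    apply/nondecreasing_seqP => n.
    by rewrite !normedE big_nat_recr//= lerDl.
  exists (1 + s) => _ [n _ <-]; rewrite normedE.
  (* Absolute convergence by AM-GM: expanding 2^k (2^-k - |a k|)^2 >= 0 bounds |a k| by the k-th
     term of this sum. *)
  apply: (@le_trans _ _ (\sum_(0 <= k < n) (2^-1 ^+ k.+1 + 2 ^+ k * a k ^+ 2))).
    apply: ler_sum => k _.
    have h : 2 ^+ k * `|a k| ^+ 2 = 2 ^+ k * a k ^+ 2.
      by rewrite real_normK ?num_real.
    have := sqr_ge0 (2^-1 ^+ k - `|a k|).
    have : (2^-1 : R) ^+ k * 2 ^+ k = 1 by rewrite -exprMn mulVf// expr1n.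
    have : 0 < (2 : R) ^+ k by rewrite exprn_gt0.
    rewrite -h (exprS _ k).
    set x := 2^-1 ^+ k; set y := 2 ^+ k; set z := `|a k| => y0 xy1 xz.
    have : 0 <= y * (x - z) ^+ 2 by rewrite mulr_ge0// ltW.
    have -> : y * (x - z) ^+ 2 = (x * y) * x - (x * y) * z *+ 2 + y * z ^+ 2.
      by ring.
    rewrite xy1; have : 0 <= y * z ^+ 2 by rewrite mulr_ge0 ?sqr_ge0// ltW.
    lra.
  rewrite big_split/= lerD//.
  suff -> : \sum_(0 <= k < n) (2^-1 : R) ^+ k.+1 = 1 - 2^-1 ^+ n.
    by rewrite gerBl exprn_ge0.
  elim: n => [|n IH]; first by rewrite big_geq// subrr.
  by rewrite big_nat_recr//= IH exprS; lra.
exists (limn (series a)) => // n.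
have : (series a m - series a n) ^+ 2 @[m --> \oo] -->
    (limn (series a) - series a n) ^+ 2.
  by rewrite expr2; apply: cvgM; apply: cvgB => //; exact: cvg_cst.
move=> h; rewrite -(cvg_lim _ h)//; apply: limr_le.
  by apply/cvg_ex; eexists; exact: h.
by near=> m; apply: inc; near: m; exact: nbhs_infty_ge.
Unshelve. all: by end_near. Qed.

Section dyadic_energy.
Context (R : realType).
Implicit Types a : R^nat.
Local Open Scope ereal_scope.

(* Finiteness forces the series of a to converge, with a quantitative tail. *)
Definition dyadic_energy a : \bar R := \sum_(n <oo) (2 ^+ n * a n ^+ 2)%:E.

Let term_ge0 a n : 0 <= (2 ^+ n * a n ^+ 2)%:E.
Proof. by rewrite lee_fin mulr_ge0 ?sqr_ge0// exprn_ge0. Qed.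

Lemma dyadic_energy_ge0 a : 0 <= dyadic_energy a.
Proof. by apply: nneseries_ge0 => n _ _; exact: term_ge0. Qed.

Lemma dyadic_energy_cvg a : dyadic_energy a < +oo ->
  exists2 l, series a @ \oo --> l & forall n,
    ((l - series a n) ^+ 2)%:E <= (2 * 2^-1 ^+ n)%:E * dyadic_energy a.
Proof.
move=> afin; have aE : dyadic_energy a = (fine (dyadic_energy a))%:E.
  by rewrite fineK// ge0_fin_numE ?dyadic_energy_ge0.
have [|l al la] := @dyadic_series_cvg _ a (fine (dyadic_energy a)).
  move=> n; rewrite -lee_fin -aE -sumEFin.
  by apply: nneseries_lim_ge => k _ _; exact: term_ge0.
by exists l => // n; rewrite aE -EFinM lee_fin.
Qed.

(** Since b = a - (a - b), one has b^2 <= 2 a^2 + 2 (a - b)^2. With a the increments at x and a - b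
    their jumps from x to y, finiteness passes from x to y. *)
Lemma dyadic_energy_subr_lty (a b : R^nat) :
  dyadic_energy a < +oo -> dyadic_energy (fun n => a n - b n)%R < +oo ->
  dyadic_energy b < +oo.
Proof.
move=> afin abfin.
apply: (@le_lt_trans _ _ (2%:E * dyadic_energy a +
    2%:E * dyadic_energy (fun n => a n - b n)%R)).
  have Zl c : 2%:E * dyadic_energy c =
      \sum_(n <oo) (2%:E * (2 ^+ n * c n ^+ 2)%:E).
    by rewrite nneseriesZl// => n _; exact: term_ge0.
  rewrite !Zl -nneseriesD; last 2 first.
  - by move=> n _ _; rewrite mule_ge0.
  - move=> n _ _; rewrite mule_ge0//.
    exact: (term_ge0 (fun n => a n - b n)%R).
  apply: lee_nneseries => // n _.
  rewrite -!EFinM -EFinD lee_fin.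
  have : (0 <= 2 ^+ n * (a n + (a n - b n)) ^+ 2)%R.
    by rewrite mulr_ge0 ?sqr_ge0// exprn_ge0.
  by rewrite !expr2; lra.
by rewrite lte_add_pinfty// lte_mul_pinfty ?dyadic_energy_ge0.
Qed.

End dyadic_energy.

Section integral_dyadic_energy.
Context d (T : measurableType d) (R : realType) (mu : {measure set T -> \bar R}).
Local Open Scope ereal_scope.

Lemma measurable_dyadic_energy (D : set T) (a : nat -> T -> R) :
  (forall n, measurable_fun D (a n)) ->
  measurable_fun D (fun x => dyadic_energy (a ^~ x) : \bar R).
Proof.
move=> ma.
apply: (@ge0_emeasurable_sum _ _ _ _
  (fun n x => (2 ^+ n * a n x ^+ 2)%:E) xpredT).
  by move=> k x _ _; rewrite lee_fin mulr_ge0 ?sqr_ge0// exprn_ge0.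
move=> k _; apply/measurable_EFinP; apply: measurable_funM => //.
exact: measurable_funX.
Qed.

(** The n-th term contributes at most 2^n * C * 4^-n = C * 2^-n. It is used with weight 1 on Omega
    and with the kernel as weight on the product. *)
Lemma integral_dyadic_energy_le (D : set T) (a : nat -> T -> R) (w : T -> R)
    (C : R) : measurable D ->
  (forall n, measurable_fun D (a n)) -> measurable_fun D w ->
  (forall x, D x -> 0 <= w x)%R -> (0 <= C)%R ->
  (forall n, \int[mu]_(x in D) (a n x ^+ 2 * w x)%:E <= (C * 4^-1 ^+ n)%:E) ->
  \int[mu]_(x in D) (dyadic_energy (a ^~ x) * (w x)%:E) <= (2 * C)%:E.
Proof.
move=> mD ma mw w0 C0 aC.
have term0 n x : D x -> 0 <= (a n x ^+ 2 * w x)%:E.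
  by move=> Dx; rewrite lee_fin mulr_ge0 ?sqr_ge0 ?w0.
have mterm n : measurable_fun D (fun x => (a n x ^+ 2 * w x)%:E).
  apply/measurable_EFinP; apply: measurable_funM => //.
  exact: measurable_funX.
have -> : \int[mu]_(x in D) (dyadic_energy (a ^~ x) * (w x)%:E) =
    \int[mu]_(x in D) \sum_(n <oo) ((2 ^+ n)%:E * (a n x ^+ 2 * w x)%:E).
  apply: eq_integral => x; rewrite inE => Dx.
  rewrite muleC -nneseriesZl; last first.
    by move=> n _; rewrite lee_fin mulr_ge0 ?sqr_ge0// exprn_ge0.
  by apply: eq_eseriesr => n _; rewrite -!EFinM; congr EFin; ring.
rewrite integral_nneseries//; last 2 first.
  by move=> n; exact: measurable_funeM.
  by move=> n x Dx; rewrite mule_ge0 ?term0// lee_fin exprn_ge0.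
apply: lime_le.
  apply: is_cvg_nneseries => n _ _.
  by apply: integral_ge0 => x Dx; rewrite mule_ge0 ?term0// lee_fin exprn_ge0.
apply: nearW => n.
apply: (@le_trans _ _ (\sum_(0 <= k < n) (C * 2^-1 ^+ k)%:E)).
  apply: lee_sum => k _.
  rewrite ge0_integralZl//; last by move=> x Dx; exact: term0.
  have -> : (C * 2^-1 ^+ k)%:E = (2 ^+ k)%:E * (C * 4^-1 ^+ k)%:E.
    rewrite -EFinM; congr EFin.
    rewrite (_ : 4^-1 = 2^-1 * 2^-1)%R; last by field.
    have e : (2 ^+ k * 2^-1 ^+ k = 1 :> R)%R by rewrite -exprMn mulfV// expr1n.
    rewrite exprMn; transitivity (C * 2^-1 ^+ k * (2 ^+ k * 2^-1 ^+ k))%R.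
      by rewrite e mulr1.
    by ring.
  by rewrite lee_wpmul2l// lee_fin exprn_ge0.
rewrite sumEFin lee_fin -mulr_sumr mulrC ler_wpM2r//.
suff -> : (\sum_(0 <= k < n) (2^-1 : R) ^+ k = 2 - 2 * 2^-1 ^+ n)%R.
  by rewrite gerBl mulr_ge0// exprn_ge0.
elim: n => [|n IH]; first by rewrite big_geq// expr0; ring.
by rewrite big_nat_recr//= IH exprS; lra.
Qed.

Lemma ge0_integral_lty_ae (D : set T) (f : T -> \bar R) : measurable D ->
  measurable_fun D f -> (forall x, D x -> 0 <= f x) ->
  \int[mu]_(x in D) f x < +oo -> {ae mu, forall x, D x -> f x < +oo}.
Proof.
move=> mD mf f0 foo; have : mu.-integrable D f.
  apply/integrableP; split => //.
  by under eq_integral => x /[!inE] Dx do rewrite gee0_abs ?f0//.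
move/(integrable_ae mD); apply: filterS => x /[apply].
by rewrite fin_numElt => /andP[].
Qed.

End integral_dyadic_energy.

(** * Almost-everywhere statements on a product space *)

Section product_ae.
Context d (T : measurableType d) (R : realType)
  (mu : {sigma_finite_measure set T -> \bar R}).
Local Open Scope ereal_scope.
Local Notation M := (mu \x mu).

Lemma ae_prod_xsection (P : T * T -> Prop) : {ae M, forall z, P z} ->
  {ae mu, forall x, {ae mu, forall y, P (x, y)}}.
Proof.
move=> [N [mN N0 PN]].
have : ae_eq mu setT (mu \o xsection N) (cst 0).
  apply/(ae_eq_integral_abs mu measurableT).
    exact: measurable_fun_xsection.
  by rewrite -[RHS]N0; apply: eq_integral => x _; rewrite gee0_abs.
apply: filterS => x /(_ Logic.I)/= Nx0; exists (xsection N x); split => //.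
  exact: measurable_xsection.
by move=> y Pxy; rewrite /xsection/= inE; apply: PN.
Qed.

Lemma ae_prod_ysection (P : T * T -> Prop) : {ae M, forall z, P z} ->
  {ae mu, forall y, {ae mu, forall x, P (x, y)}}.
Proof.
move=> [N [mN N0 PN]].
(* The product measure [\x] integrates the measures of x-sections; uniqueness identifies it with
   [\x^], which integrates those of y-sections. *)
have {}N0 : (mu \x^ mu) N = 0.
  rewrite -N0; apply/esym; apply: product_measure_unique => //= A B mA mB.
  exact: product_measure2E.
have : ae_eq mu setT (mu \o ysection N) (cst 0).
  apply/(ae_eq_integral_abs mu measurableT).
    exact: measurable_fun_ysection.
  by rewrite -[RHS]N0; apply: eq_integral => x _; rewrite gee0_abs.
apply: filterS => y /(_ Logic.I)/= Ny0; exists (ysection N y); split => //.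
  exact: measurable_ysection.
by move=> x Pxy; rewrite /ysection/= inE; apply: PN.
Qed.

Lemma ae_prod_snd (P : T -> Prop) : {ae mu, forall x, P x} ->
  {ae M, forall z, P z.2}.
Proof.
move=> [N [mN N0 PN]]; exists (setT `*` N); split.
- exact: measurableX.
- by rewrite product_measure1E// N0 mule0.
- by move=> z Pz; split => //; exact: PN.
Qed.

Lemma ae_prod_fst (P : T -> Prop) : {ae mu, forall x, P x} ->
  {ae M, forall z, P z.1}.
Proof.
move=> [N [mN N0 PN]]; exists (N `*` setT); split.
- exact: measurableX.
- rewrite product_measure1E//; transitivity (0 * mu setT); last exact: mul0e.
  by congr (_ * _).
- by move=> z Pz; split => //; exact: PN.
Qed.

(* Almost every y in G sees, through k, a non-negligible set of x in O, hence
   one x that is good for both hypotheses. *)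
Lemma ae_kernel_transfer (O G : set T) (k : T * T -> R) (Q P : T -> Prop)
    (A : T * T -> Prop) :
  measurable_fun setT k -> (forall z, 0 <= k z)%R ->
  (forall z, 0 < k z -> O z.1)%R ->
  {ae mu, forall y, G y -> 0 < \int[mu]_x (k (x, y))%:E} ->
  {ae mu, forall x, O x -> Q x} ->
  {ae M, forall z, (0 < k z)%R -> A z} ->
  (forall x y, Q x -> A (x, y) -> P y) ->
  {ae mu, forall y, G y -> P y}.
Proof.
move=> mk k0 kO kG OQ /ae_prod_ysection kA QAP.
apply: filterS2 kG kA => y ky Ay Gy; have {ky} := ky Gy.
apply: contraPP => nPy; apply/negP; rewrite -leNgt.
suff -> : \int[mu]_x (k (x, y))%:E = \int[mu]_x cst 0 x by rewrite integral0.
apply: ge0_ae_eq_integral => //.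
- apply/measurable_EFinP; exact: measurableT_comp.
- by move=> x _; rewrite lee_fin.
- apply: filterS2 OQ Ay => x Qx Axy _ /=; congr EFin; apply/eqP.
  rewrite eq_le k0 andbT leNgt; apply/negP => kxy.
  by apply/nPy/(QAP x) => //; [apply: Qx; exact: (kO (x, y))|exact: Axy].
Qed.

End product_ae.

(** * The nonlocal energy space of a kernel *)

Section weighted_square.
Context d (T : measurableType d) (R : realType) (mu : {measure set T -> \bar R}).
Context (D : set T) (w : T -> R).
Hypothesis mD : measurable D.
Hypothesis mw : measurable_fun D w.
Hypothesis w_ge0 : forall x, D x -> 0 <= w x.
Local Open Scope ereal_scope.

(** One notion serves for both quantities: the L2 mass is the case of weight 1 on [O], the energy
    that of the weight [k] and a jump function on the product. *)
Definition weighted_sqr (f : T -> R) : \bar R :=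
  \int[mu]_(x in D) (f x ^+ 2 * w x)%:E.

Lemma weighted_sqr_ge0 f : 0 <= weighted_sqr f.
Proof.
by apply: integral_ge0 => x Dx; rewrite lee_fin mulr_ge0 ?sqr_ge0 ?w_ge0.
Qed.

Lemma weighted_sqr_fineK f : weighted_sqr f < +oo ->
  (fine (weighted_sqr f))%:E = weighted_sqr f.
Proof. by move=> ?; rewrite fineK// ge0_fin_numE// weighted_sqr_ge0. Qed.

Lemma weighted_sqr0 f : f =1 (fun=> 0%R) -> weighted_sqr f = 0.
Proof. by move=> f0; apply: integral0_eq => x _; rewrite f0 expr0n mul0r. Qed.

Let mM (f g : T -> R) : measurable_fun D f -> measurable_fun D g ->
  measurable_fun D (fun x => f x * g x * w x)%R.
Proof. by move=> mf mg; do 2 apply: measurable_funM => //. Qed.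

Let mE (f : T -> R) : measurable_fun D f ->
  measurable_fun D (fun x => (f x ^+ 2 * w x)%:E).
Proof.
move=> mf; apply/measurable_EFinP; under eq_fun do rewrite expr2.
exact: mM.
Qed.

Let E0 (f : T -> R) x : D x -> 0 <= (f x ^+ 2 * w x)%:E.
Proof. by move=> Dx; rewrite lee_fin mulr_ge0 ?sqr_ge0 ?w_ge0. Qed.

Lemma weighted_sqr_comb_le (a : R) (f g : T -> R) :
  measurable_fun D f -> measurable_fun D g ->
  weighted_sqr (fun x => a * f x + g x)%R <=
  (2 * a ^+ 2)%:E * weighted_sqr f + 2%:E * weighted_sqr g.
Proof.
move=> mf mg.
have a0 : (0 <= 2 * a ^+ 2)%R by rewrite mulr_ge0 ?sqr_ge0.
rewrite /weighted_sqr -!ge0_integralZl//;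
  [|exact: mE|exact: E0|exact: mE|exact: E0].
rewrite -ge0_integralD//; last 4 first.
- by move=> x Dx; rewrite mule_ge0// E0.
- exact/measurable_funeM/mE.
- by move=> x Dx; rewrite mule_ge0// E0.
- exact/measurable_funeM/mE.
apply: ge0_le_integral => //.
- by move=> x Dx; exact: (E0 (fun x => a * f x + g x)%R).
- apply: (mE (f := fun x => a * f x + g x)%R).
  by apply: measurable_funD => //; exact: measurable_funM.
- by apply: emeasurable_funD; apply: measurable_funeM; exact: mE.
move=> x Dx; rewrite -!EFinM -EFinD lee_fin.
have : (0 <= w x * (a * f x - g x) ^+ 2)%R by rewrite mulr_ge0 ?sqr_ge0 ?w_ge0.
by rewrite !expr2; lra.
Qed.

Lemma weighted_sqr_comb_lty (a : R) (f g : T -> R) :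
  measurable_fun D f -> measurable_fun D g ->
  weighted_sqr f < +oo -> weighted_sqr g < +oo ->
  weighted_sqr (fun x => a * f x + g x)%R < +oo.
Proof.
move=> mf mg foo goo; apply: (le_lt_trans (weighted_sqr_comb_le _ mf mg)).
by rewrite lte_add_pinfty// lte_mul_pinfty// lee_fin mulr_ge0 ?sqr_ge0.
Qed.

Lemma integrable_weighted_sqr (f : T -> R) : measurable_fun D f ->
  weighted_sqr f < +oo ->
  mu.-integrable D (EFin \o (fun x => f x ^+ 2 * w x)%R).
Proof.
move=> mf foo; apply/integrableP; split; first exact: mE.
by under eq_integral => x /[!inE] Dx do rewrite gee0_abs ?E0//.
Qed.

Let normr_prod_le (f g : T -> R) x : D x ->
  (`|f x * g x * w x| <= f x ^+ 2 * w x + g x ^+ 2 * w x)%R.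
Proof.
move=> Dx; rewrite normrM (ger0_norm (w_ge0 Dx)) -mulrDl.
rewrite ler_wpM2r ?w_ge0// ler_norml.
have := sqr_ge0 (f x - g x); have := sqr_ge0 (f x + g x).
have := sqr_ge0 (f x); have := sqr_ge0 (g x).
by rewrite !expr2 => ? ? ? ?; apply/andP; split; lra.
Qed.

Lemma integrable_weighted_prod (f g : T -> R) :
  measurable_fun D f -> measurable_fun D g ->
  weighted_sqr f < +oo -> weighted_sqr g < +oo ->
  mu.-integrable D (EFin \o (fun x => f x * g x * w x)%R).
Proof.
move=> mf mg foo goo; apply: (le_integrable mD _ _ (integrableD mD
  (integrable_weighted_sqr mf foo) (integrable_weighted_sqr mg goo))).
  by apply/measurable_EFinP; exact: mM.
move=> x Dx; rewrite /= lee_fin.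
by rewrite (le_trans (normr_prod_le f g Dx))// ler_norm.
Qed.

(** A sum in place of the Cauchy-Schwarz product is enough for a bound on a unit ball; homogeneity
    is restored later by scaling. *)
Lemma normr_weighted_prod_le (f g : T -> R) :
  measurable_fun D f -> measurable_fun D g ->
  weighted_sqr f < +oo -> weighted_sqr g < +oo ->
  (`|\int[mu]_(x in D) (f x * g x * w x)| <=
    fine (weighted_sqr f) + fine (weighted_sqr g))%R.
Proof.
move=> mf mg foo goo.
have ifg := integrable_weighted_prod mf mg foo goo.
have iff := integrable_weighted_sqr mf foo.
have igg := integrable_weighted_sqr mg goo.
apply: (le_trans (le_normr_Rintegral mD ifg)).
rewrite -[leRHS](RintegralD mD iff igg); apply: le_Rintegral => //.
- exact: integrable_norm ifg.
- have := integrableD mD iff igg.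
  by apply: eq_integrable => // x _; rewrite /= EFinD.
- by move=> x Dx; exact: normr_prod_le.
Qed.

Lemma weighted_sqr_eq0_ae f : measurable_fun D f -> weighted_sqr f = 0 ->
  {ae mu, forall x, D x -> (0 < w x)%R -> f x = 0%R}.
Proof.
move=> mf f0; have : ae_eq mu D (fun x => (f x ^+ 2 * w x)%:E) (cst 0).
  apply/(ae_eq_integral_abs mu mD); first exact: mE.
  by under eq_integral => x /[!inE] Dx do rewrite gee0_abs ?E0//.
apply: filterS => x /[apply] -[/eqP] + wx.
by rewrite mulf_eq0 sqrf_eq0 (gt_eqF wx) orbF => /eqP.
Qed.

End weighted_square.

Definition jump (T : Type) (R : realType) (v : T -> R) (z : T * T) : R :=
  v z.1 - v z.2.

Section nonlocal_space.
Context d (T : measurableType d) (R : realType)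
  (mu : {sigma_finite_measure set T -> \bar R}).
Context (O : set T) (k : T * T -> R).
Local Notation M := (mu \x mu)%E.
Implicit Types u v w : T -> R.

Definition jump_energy v := weighted_sqr M setT k (jump v).

Definition mass v := weighted_sqr mu O (cst 1) v.

Definition nonlocal_space : set (T -> R) := [set v |
  [/\ measurable_fun setT v, (mass v < +oo)%E & (jump_energy v < +oo)%E]].

Definition jump_form u v := \int[M]_z (jump u z * jump v z * k z).

Hypothesis mO : measurable O.
Hypothesis mk : measurable_fun setT k.
Hypothesis k_ge0 : forall z, 0 <= k z.
Local Notation V := nonlocal_space.

Lemma measurable_jump v : measurable_fun setT v -> measurable_fun setT (jump v).
Proof. by move=> mv; apply: measurable_funB; exact: measurableT_comp. Qed.

Lemma jump_comb (a : R) u v :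
  jump (fun x => a * u x + v x) = (fun z => a * jump u z + jump v z).
Proof. by apply/funext => z; rewrite /jump; ring. Qed.

Lemma nonlocal_space_comb a u v : V u -> V v -> V (fun x => a * u x + v x).
Proof.
move=> [mu_ uM uQ] [mv vM vQ]; split.
- by apply: measurable_funD => //; exact: measurable_funM.
- apply: weighted_sqr_comb_lty => //; exact: measurable_funS measurableT _ _.
- by rewrite /jump_energy jump_comb; apply: weighted_sqr_comb_lty => //;
    exact: measurable_jump.
Qed.

Lemma nonlocal_space_cst c : (mu O < +oo)%E -> V (cst c).
Proof.
move=> muO; split; first exact: measurable_cst.
- have -> : mass (cst c) = (\int[mu]_(x in O) cst (c ^+ 2)%:E x)%E.
    by apply: eq_integral => x _; rewrite /= mulr1.
  by rewrite integral_cst// lte_mul_pinfty// lee_fin sqr_ge0.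
- rewrite /jump_energy /weighted_sqr integral0_eq// => z _.
  by rewrite /jump subrr expr0n mul0r.
Qed.

Lemma integrable_jump_prod u v : V u -> V v ->
  M.-integrable setT (EFin \o (fun z => jump u z * jump v z * k z)).
Proof.
by move=> [mu_ _ uQ] [mv _ vQ]; apply: integrable_weighted_prod => //;
  exact: measurable_jump.
Qed.

Lemma jump_form_comb a u v w : V u -> V v -> V w ->
  jump_form (fun x => a * u x + v x) w = a * jump_form u w + jump_form v w.
Proof.
move=> Vu Vv Vw; rewrite /jump_form -RintegralZl//; last first.
  exact: integrable_jump_prod.
rewrite -RintegralD//; last 2 first.
- have := integrableZl measurableT a (integrable_jump_prod Vu Vw).
  by apply: eq_integrable => // z _; rewrite /= EFinM.
- exact: integrable_jump_prod.
by apply: eq_Rintegral => z _; rewrite jump_comb; ring.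
Qed.

Lemma jump_formC u v : jump_form u v = jump_form v u.
Proof. by apply: eq_Rintegral => z _; rewrite [jump u z * _]mulrC. Qed.

Lemma jump_form_energy u : V u -> (jump_form u u)%:E = jump_energy u.
Proof.
move=> [mu_ _ uQ]; rewrite -[RHS]weighted_sqr_fineK//; congr EFin.
Qed.

Lemma jump_form_ge0 u : 0 <= jump_form u u.
Proof.
by apply: Rintegral_ge0 => z _; rewrite mulr_ge0// -expr2 sqr_ge0.
Qed.

End nonlocal_space.

(** * Completeness and Riesz representation under a Poincare inequality *)

Section nonlocal_poincare.
Context d (T : measurableType d) (R : realType)
  (mu : {sigma_finite_measure set T -> \bar R}).
Context (O G : set T) (k : T * T -> R).
Local Notation M := (mu \x mu)%E.
Local Notation V := (nonlocal_space mu O k).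
Implicit Types u w : T -> R.
Hypothesis mO : measurable O.
Hypothesis mk : measurable_fun setT k.
Hypothesis k_ge0 : forall z, 0 <= k z.
Hypothesis k_supp : forall z, 0 < k z -> O z.1 /\ (O `|` G) z.2.
Hypothesis k_exterior :
  {ae mu, forall y, G y -> (0 < \int[mu]_x (k (x, y))%:E)%E}.
Hypothesis muO : (mu O < +oo)%E.

Let ae_exterior (Q P : T -> Prop) (A : T * T -> Prop) :
  {ae mu, forall x, O x -> Q x} -> {ae M, forall z, 0 < k z -> A z} ->
  (forall x y, Q x -> A (x, y) -> P y) -> {ae mu, forall y, G y -> P y}.
Proof.
apply: ae_kernel_transfer => // z kz; exact: (k_supp kz).1.
Qed.

Let VB (c : R) u : V u -> V (fun x => u x - c).
Proof.
move=> Vu.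
rewrite (_ : (fun x => _) = (fun x => (-1) * cst c x + u x)); last first.
  by apply/funext => x /=; rewrite mulN1r addrC.
exact: nonlocal_space_comb (nonlocal_space_cst _ _ _ _) _.
Qed.

Let jumpB u (c : R) : jump (fun x => u x - c) = jump u.
Proof. by apply/funext => z; rewrite /jump; ring. Qed.

Section completeness.
Variable K : R.
Hypothesis K_ge0 : 0 <= K.
Hypothesis poincare : forall v, V v -> exists c,
  (mass mu O (fun x => v x - c)%R <= K%:E * jump_energy mu k v)%E.

Variable v : nat -> T -> R.
Hypothesis Vv : forall n, V (v n).
Hypothesis v_cauchy : forall n,
  (jump_energy mu k (fun x => v n.+1 x - v n x)%R <= (4^-1 ^+ n)%:E)%E.

(** The limit is v_0 plus the pointwise sum of the centred increments. The rate 4 * 2^-n is the tail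
    factor 2 * 2^-n of [dyadic_energy_cvg] times the bound 2 on the integral of the dyadic energy of
    the jumps. *)
Lemma nonlocal_space_complete : exists2 u, V u &
  forall n, (jump_energy mu k (fun x => v n x - u x)%R <=
    (4 * 2^-1 ^+ n)%:E)%E.
Proof.
pose D n x := v n.+1 x - v n x.
have VD n : V (D n).
  rewrite (_ : D n = (fun x => (-1) * v n x + v n.+1 x)); last first.
    by apply/funext => x /=; rewrite mulN1r addrC.
  exact: nonlocal_space_comb.
have /choice[c Hc] : forall n, exists c, (mass mu O (fun x => D n x - c)%R <=
    K%:E * (4^-1 ^+ n)%:E)%E.
  move=> n; have [c Hc] := poincare (VD n); exists c.
  apply: (le_trans Hc).
  by apply: lee_wpmul2l; [rewrite lee_fin|exact: v_cauchy].
pose a n x := D n x - c n.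
have Va n : V (a n) by exact: VB.
have ma n : measurable_fun setT (a n) by have [] := Va n.
have ja n : jump (a n) = jump (D n) by exact: jumpB.
pose e x := dyadic_energy (a ^~ x).
pose e2 z := dyadic_energy (fun n => jump (a n) z).
have me : measurable_fun setT e by exact: measurable_dyadic_energy.
have me2 : measurable_fun setT e2.
  by apply: measurable_dyadic_energy => n; exact: measurable_jump.
have e_int : (\int[mu]_(x in O) (e x * (cst 1 x)%:E) <= (2 * K)%:E)%E.
  apply: integral_dyadic_energy_le => // n.
  exact: measurable_funS (ma n).
have e2_int : (\int[M]_z (e2 z * (k z)%:E) <= (2 * 1)%:E)%E.
  apply: integral_dyadic_energy_le => // n.
    exact: measurable_jump.
  by rewrite mul1r ja; exact: v_cauchy.
have e_O : {ae mu, forall x, O x -> (e x < +oo)%E}.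
  have := @ge0_integral_lty_ae _ _ _ mu O e mO
    (measurable_funS measurableT _ me).
  apply => //; first by move=> x _; exact: dyadic_energy_ge0.
  under eq_integral do rewrite -[e _]mule1.
  exact: le_lt_trans e_int (ltry _).
have me2k : measurable_fun setT (fun z => e2 z * (k z)%:E)%E.
  by apply: emeasurable_funM => //; exact/measurable_EFinP.
have e2k_ge0 z : (0 <= e2 z * (k z)%:E)%E.
  by rewrite mule_ge0 ?lee_fin// dyadic_energy_ge0.
have e2_M : {ae M, forall z, 0 < k z -> (e2 z < +oo)%E}.
  have := @ge0_integral_lty_ae _ _ _ M setT _ measurableT me2k.
  have e2oo := le_lt_trans e2_int (ltry _).
  move=> /(_ (fun z _ => e2k_ge0 z) e2oo).
  apply: filterS => z /(_ Logic.I) + kz.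
  rewrite !ltey; apply: contra => /eqP ->.
  by rewrite gt0_mulye// lte_fin.
have e_G : {ae mu, forall y, G y -> (e y < +oo)%E}.
  apply: (ae_exterior e_O e2_M) => x y ex exy.
  exact: dyadic_energy_subr_lty ex exy.
have e_OG : {ae mu, forall y, (O `|` G) y -> (e y < +oo)%E}.
  by apply: filterS2 e_O e_G => y yO yG [/yO|/yG].
pose A := [set x | (e x < +oo)%E].
have mA : measurable A.
  rewrite -[A]setTI; apply: emeasurable_fun_infty_o => //.
(* The indicator of [A] makes the series converge at every point, to 0 off [A], so that [l] is
   measurable as a pointwise limit. *)
pose l x := limn (series (fun n => a n x * \1_A x)).
have l_cvg x : series (fun n => a n x * \1_A x) @ \oo --> l x.
  have : (dyadic_energy (fun n => a n x * \1_A x)%R < +oo)%E.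
    rewrite indicE; have [|xA] := boolP (x \in A).
      rewrite inE /A/= => ex.
      by under [X in dyadic_energy X]eq_fun do rewrite mulr1.
    under [X in dyadic_energy X]eq_fun do rewrite mulr0.
    by rewrite /dyadic_energy eseries0// => n _ _; rewrite expr0n mulr0.
  by move=> /dyadic_energy_cvg[l' l'_cvg _]; apply/cvg_ex; exists l'.
have ml : measurable_fun setT l.
  apply: (@measurable_fun_cvg _ _ _ _
    (fun m x => series (fun n => a n x * \1_A x) m)).
    move=> m; apply: measurable_sum => n.
    by apply: measurable_funM => //; exact: measurable_indic.
  by move=> x _; exact: l_cvg.
have l_cvgA x : A x -> series (a ^~ x) @ \oo --> l x.
  move=> Ax; have := l_cvg x; rewrite indicE mem_set//.
  by under [X in series X @ \oo]eq_fun do rewrite mulr1.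
have l_tail x n : A x -> (((l x - series (a ^~ x) n) ^+ 2)%:E <=
    (2 * 2^-1 ^+ n)%:E * e x)%E.
  move=> Ax; have [l' l'_cvg l'_tail] := dyadic_energy_cvg Ax.
  by rewrite (cvg_unique _ (l_cvgA x Ax) l'_cvg).
have jl_tail z n : A z.1 -> A z.2 -> (e2 z < +oo)%E ->
    (((jump l z - series (fun n => jump (a n) z) n) ^+ 2)%:E <=
    (2 * 2^-1 ^+ n)%:E * e2 z)%E.
  move=> Az1 Az2 ez; have [l' l'_cvg l'_tail] := dyadic_energy_cvg ez.
  suff -> : jump l z = l' by [].
  apply: cvg_unique l'_cvg => //=.
  have <- : series (a ^~ z.1) \- series (a ^~ z.2) =
      series (fun n => jump (a n) z).
    by apply/funext => m; rewrite /series/= -sumrB.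
  by apply: cvgB; exact: l_cvgA.
have A_M : {ae M, forall z, 0 < k z -> A z.1 /\ A z.2}.
  apply: filterS2 (ae_prod_fst e_O) (ae_prod_snd e_OG) => z z1 z2 kz.
  by have [/z1 ? /z2] := k_supp kz.
have mtail n : measurable_fun setT
    (fun z => jump l z - series (fun n => jump (a n) z) n).
  apply: measurable_funB; first exact: measurable_jump.
  by apply: measurable_sum => m; exact: measurable_jump.
have Q_tail n : (weighted_sqr M setT k
    (fun z => jump l z - series (fun n => jump (a n) z) n)%R <=
    (4 * 2^-1 ^+ n)%:E)%E.
  have c0 : (0 <= (2 * 2^-1 ^+ n)%:E :> \bar R)%E.
    by rewrite lee_fin mulr_ge0// exprn_ge0.
  apply: (@le_trans _ _
      (\int[M]_z ((2 * 2^-1 ^+ n)%:E * (e2 z * (k z)%:E)))%E).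
    apply: ae_ge0_le_integral => //.
    - by move=> z _; rewrite lee_fin mulr_ge0// sqr_ge0.
    - apply/measurable_EFinP; apply: measurable_funM => //.
      exact: measurable_funX.
    - by move=> z _; rewrite mule_ge0.
    - exact: measurable_funeM.
    apply: filterS2 A_M e2_M => z Az ez _.
    have [kz|kz] := leP (k z) 0.
      have -> : k z = 0 by apply/eqP; rewrite eq_le kz k_ge0.
      by rewrite mulr0 !mule0.
    rewrite muleA EFinM lee_wpmul2r ?lee_fin//.
    by apply: jl_tail; [exact: (Az kz).1|exact: (Az kz).2|exact: ez].
  rewrite ge0_integralZl//.
  apply: (le_trans (lee_wpmul2l c0 e2_int)).
  by rewrite -EFinM lee_fin; lra.
have me1 : measurable_fun O (fun x => e x * (cst 1 x)%:E)%E.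
  under eq_fun do rewrite mule1.
  exact: (measurable_funS measurableT _ me).
have Vl : V l.
  split => //.
    apply: (@le_lt_trans _ _
        (\int[mu]_(x in O) (2%:E * (e x * (cst 1 x)%:E)))%E).
      apply: ae_ge0_le_integral => //.
      - by move=> x _; rewrite lee_fin mulr_ge0// sqr_ge0.
      - apply/measurable_EFinP; apply: measurable_funM => //.
        by apply: measurable_funX; exact: (measurable_funS measurableT _ ml).
      - by move=> x _; rewrite mule_ge0// mule_ge0 ?lee_fin// dyadic_energy_ge0.
      - exact: measurable_funeM.
      (* At n = 0 the partial sum is empty, so the tail estimate bounds [l] itself. *)
      apply: filterS e_O => x ex /ex Ax; have := l_tail x 0%N Ax.
      by rewrite /series/= big_geq// subr0 expr0 !mulr1 mule1.
    rewrite ge0_integralZl//; last first.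
      by move=> x _; rewrite mule_ge0 ?lee_fin// dyadic_energy_ge0.
    by apply: (le_lt_trans (lee_wpmul2l _ e_int)); rewrite // -EFinM ltry.
  apply: le_lt_trans (ltry (4 * 2^-1 ^+ 0)); apply: le_trans (Q_tail 0%N).
  rewrite le_eqVlt; apply/orP; left; apply/eqP; apply: eq_integral => z _.
  by rewrite /series/= big_geq// subr0.
(* The constants removed from the increments add up to a constant, which no jump sees. *)
have vE n x : v n x = v 0%N x + series (a ^~ x) n + \sum_(0 <= m < n) c m.
  elim: n => [|n IH]; first by rewrite /series/= !big_geq// !addr0.
  by rewrite /series/= !big_nat_recr//= /a /D IH /series/=; ring.
exists (fun x => 1 * v 0%N x + l x); first exact: nonlocal_space_comb.
move=> n; apply: le_trans (Q_tail n).
rewrite le_eqVlt; apply/orP; left; apply/eqP; apply: eq_integral => z _.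
suff -> : jump (fun x => v n x - (1 * v 0%N x + l x)) z =
    - (jump l z - series (fun m => jump (a m) z) n) by rewrite sqrrN.
have -> : series (fun m => jump (a m) z) n =
    series (a ^~ z.1) n - series (a ^~ z.2) n by rewrite /series/= -sumrB.
rewrite /jump (vE n z.1) (vE n z.2).
move: (series _ _) (series _ _) (\sum_(_ <= _ < _) _).
by move=> s1 s2 s3; ring.
Qed.
End completeness.

Section poincare.
Variable K : R.
Hypothesis K_ge0 : 0 <= K.
Hypothesis poincare : forall v, V v -> exists c,
  (mass mu O (fun x => v x - c)%R <= K%:E * jump_energy mu k v)%E.

Lemma jump_energy_eq0_cst w : V w -> jump_energy mu k w = 0%E ->
  exists c, {ae mu, forall x, (O `|` G) x -> w x = c}.
Proof.
move=> Vw w0; have [c] := poincare Vw; rewrite w0 mule0 => c0; exists c.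
have [mw _ _] := Vw; have [mwc _ _] := VB c Vw.
have w_O : {ae mu, forall x, O x -> w x = c}.
  have : mass mu O (fun x => w x - c) = 0%E.
    by apply/eqP; rewrite eq_le c0; apply: weighted_sqr_ge0.
  have mwcO : measurable_fun O (fun x => w x - c).
    exact: (measurable_funS measurableT _ mwc).
  move=> /(weighted_sqr_eq0_ae mO (measurable_cst _) (fun=> fun=> ler01) mwcO).
  apply: filterS => x wx /wx /(_ ltr01)/eqP.
  by rewrite subr_eq0 => /eqP.
have jw : {ae M, forall z, 0 < k z -> w z.1 = w z.2}.
  have := weighted_sqr_eq0_ae measurableT mk (fun z _ => k_ge0 z)
    (measurable_jump mw) w0.
  by apply: filterS => z /(_ Logic.I) + kz => /(_ kz)/eqP;
    rewrite subr_eq0 => /eqP.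
have w_G : {ae mu, forall y, G y -> w y = c}.
  by apply: (ae_exterior w_O jw) => x y -> /= ->.
by apply: filterS2 w_O w_G => x xO xG [/xO|/xG].
Qed.

Variable F : (T -> R) -> R.
Hypothesis FD : forall a u v, V u -> V v ->
  F (fun x => a * u x + v x) = a * F u + F v.
Hypothesis F1 : F (cst 1) = 0.
Variable B : R.
Hypothesis F_bounded : forall v, V v ->
  (mass mu O v + jump_energy mu k v <= 1)%E -> `|F v| <= B.

Let V0 : V (cst 0). Proof. exact: nonlocal_space_cst. Qed.

Let F0 : F (cst 0) = 0.
Proof.
have := FD 1 V0 V0; rewrite mul1r.
rewrite (_ : (fun x => _) = cst 0); first by lra.
by apply/funext => x /=; rewrite mulr0 addr0.
Qed.

Let B_ge0 : 0 <= B.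
Proof.
apply: (le_trans (normr_ge0 _) (F_bounded V0 _)).
rewrite /mass /jump_energy !weighted_sqr0 ?adde0 ?lee01// => z.
by rewrite /jump subrr.
Qed.

(** Dividing by s brings w into the unit ball where [F] is bounded; the 1/2 in the hypothesis pays
    for the factor 2 of [weighted_sqr_comb_le]. *)
Let F_scale_le s w : V w -> 0 < s ->
  (mass mu O w + jump_energy mu k w <= (s ^+ 2 / 2)%:E)%E ->
  F w ^+ 2 <= B ^+ 2 * s ^+ 2.
Proof.
move=> Vw s0 ws.
have -> : F w = s * F (fun x => s^-1 * w x + cst 0 x).
  by rewrite FD// F0 addr0 mulrA mulfV ?gt_eqF// mul1r.
rewrite exprMn mulrC ler_wpM2r ?sqr_ge0//.
rewrite -real_normK ?num_real// ler_sqr ?nnegrE// F_bounded//.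
  exact: nonlocal_space_comb.
have [mw _ _] := Vw.
have h1 : (mass mu O (fun x => s^-1 * w x + cst 0 x)%R <=
    (2 * s^-1 ^+ 2)%:E * mass mu O w)%E.
  have mwO : measurable_fun O w by exact: (measurable_funS measurableT _ mw).
  apply: (le_trans (weighted_sqr_comb_le mu mO (measurable_cst _)
    (fun=> fun=> ler01) s^-1 mwO (measurable_cst _))).
  by rewrite [X in (_ + _ * X)%E]weighted_sqr0// mule0 adde0.
have h2 : (jump_energy mu k (fun x => s^-1 * w x + cst 0 x)%R <=
    (2 * s^-1 ^+ 2)%:E * jump_energy mu k w)%E.
  have m0 : measurable_fun setT (jump (cst 0 : T -> R)).
    exact: measurable_jump.
  rewrite /jump_energy jump_comb.
  apply: (le_trans (weighted_sqr_comb_le M measurableT mk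
    (fun z _ => k_ge0 z) s^-1 (measurable_jump mw)
    m0)).
  by rewrite [X in (_ + _ * X)%E]weighted_sqr0 ?mule0 ?adde0// => z;
    rewrite /jump subrr.
apply: (le_trans (leeD h1 h2)); rewrite -ge0_muleDr; last 2 first.
  exact: weighted_sqr_ge0.
  exact: weighted_sqr_ge0.
apply: (le_trans (lee_wpmul2l _ ws)).
  by rewrite lee_fin mulr_ge0 ?sqr_ge0.
rewrite -EFinM lee_fin le_eqVlt; apply/orP; left; apply/eqP.
by field; rewrite gt_eqF.
Qed.

(** [F] is evaluated on v - c, whose full norm is at most (K + 1) times the form. The final + 1
    keeps the constant positive, as [semi_inner_riesz] requires. *)
Let F_form_bounded v : V v ->
  F v ^+ 2 <= (2 * B ^+ 2 * (K + 1) + 1) * jump_form mu k v v.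
Proof.
move=> Vv; have [c vc] := poincare Vv; pose w x := v x - c.
have Vw : V w := VB c Vv.
have -> : F v = F w.
  have -> : w = (fun x => (- c) * cst 1 x + v x).
    by apply/funext => x; rewrite /w /=; ring.
  by rewrite FD ?F1 ?mulr0 ?add0r//; exact: nonlocal_space_cst.
have J0 := jump_form_ge0 mu k_ge0 v.
set J := jump_form mu k v v in J0 *.
have wJ : (mass mu O w + jump_energy mu k w <= ((K + 1) * J)%:E)%E.
  rewrite /jump_energy jumpB -/(jump_energy mu k v).
  rewrite mulrDl mul1r EFinD EFinM /J (jump_form_energy k_ge0 Vv).
  by apply: leeD => //; rewrite /w.
apply: (@le_trans _ _ (2 * B ^+ 2 * ((K + 1) * J))); last first.
  by rewrite mulrA ler_wpM2r// lerDl.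
apply/ler_addgt0Pr => e e0.
(* The form may vanish at v while the scale must be positive; t is the slack, costing 2 * B^2 * t <=
   e. *)
pose t := e / (2 * B ^+ 2 + 1).
have B2 : 0 <= B ^+ 2 by exact: sqr_ge0.
have t0 : 0 < t by rewrite divr_gt0// ltr_wpDl// mulr_ge0.
have KJ : 0 <= (K + 1) * J by rewrite mulr_ge0// addr_ge0.
have st0 : 0 < 2 * ((K + 1) * J + t) by rewrite mulr_gt0// ltr_wpDl.
have := @F_scale_le (Num.sqrt (2 * ((K + 1) * J + t))) w Vw.
rewrite sqrtr_gt0 sqr_sqrtr ?(ltW st0)// => /(_ st0).
have -> : 2 * ((K + 1) * J + t) / 2 = (K + 1) * J + t by field.
move=> H; apply: (le_trans (H _)).
  by apply: (le_trans wJ); rewrite lee_fin lerDl ltW.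
have te : 2 * B ^+ 2 * t <= e.
  have -> : e = (2 * B ^+ 2 + 1) * t.
    by rewrite mulrC divfK// gt_eqF// ltr_wpDl// mulr_ge0.
  by rewrite ler_wpM2r ?lerDl// ltW.
lra.
Qed.

Lemma nonlocal_riesz : exists2 u, V u &
  forall v, V v -> jump_form mu k u v = F v.
Proof.
(* With values in [R^o] the functions form an [lmodType] with pointwise scaling. *)
apply: (@semi_inner_riesz R (T -> R^o) V (jump_form mu k) _ _ _ _ _ F
  (2 * B ^+ 2 * (K + 1) + 1)) => //.
- by move=> a u v Vu Vv; exact: nonlocal_space_comb.
- by move=> u v _ _; exact: jump_formC.
- by move=> a u v w Vu Vv Vw; exact: (jump_form_comb mk k_ge0 a Vu Vv Vw).
- by move=> u _; exact: jump_form_ge0.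
- by rewrite ltr_wpDl// !mulr_ge0 ?sqr_ge0// addr_ge0.
move=> v Vv v_cauchy.
have VvB i u : V u -> V (fun x => v i x - u x).
  move=> Vu; rewrite (_ : (fun x => _) = (fun x => (-1) * u x + v i x)).
    exact: nonlocal_space_comb.
  by apply/funext => x; rewrite mulN1r addrC.
have [n|u Vu vu] := nonlocal_space_complete K_ge0 poincare Vv.
  rewrite -(jump_form_energy k_ge0 (VvB n.+1 _ (Vv n))) lee_fin.
  exact: v_cauchy.
exists u => // e e0.
have cvg0 : 4 * (2^-1 : R) ^+ n @[n --> \oo] --> 0.
  rewrite -(mulr0 4); apply: cvgMr.
  by apply: cvg_expr; rewrite gtr0_norm ?invf_lt1// ltr1n.
near=> n; apply: (@le_lt_trans _ _ (4 * 2^-1 ^+ n)).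
  by rewrite -lee_fin (jump_form_energy k_ge0 (VvB n _ Vu)); exact: vu.
by near: n; exact: (cvgr_lt _ cvg0).
Unshelve. all: by end_near. Qed.

End poincare.
End nonlocal_poincare.

(** * Centring by averaging over a set of finite positive measure *)

Section averaging.
Context d (T : measurableType d) (R : realType)
  (mu : {sigma_finite_measure set T -> \bar R}).
Context (O : set T).
Hypothesis mO : measurable O.
Hypothesis muO : (mu O < +oo)%E.
Hypothesis muO_gt0 : (0 < mu O)%E.
Local Open Scope ereal_scope.

(* The factor 2 only avoids having to discuss when the mean value is
   attained. *)
Lemma exists_le_average (f : T -> \bar R) : measurable_fun O f ->
  (forall x, O x -> 0 <= f x) ->
  exists2 x, O x & f x <= (2 / fine (mu O))%:E * \int[mu]_(x in O) f x.
Proof.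
move=> mf f0; have muOfin : mu O \is a fin_num by rewrite ge0_fin_numE.
have m0 : (0 < fine (mu O))%R by rewrite fine_gt0// muO_gt0 muO.
have I0 : 0 <= \int[mu]_(x in O) f x by exact: integral_ge0.
have [Ioo|Ioo] := eqVneq (\int[mu]_(x in O) f x) +oo.
  have [x Ox] : exists x, O x.
    apply/set0P/eqP => O0; move: muO_gt0.
    by rewrite O0 measure0 ltxx.
  exists x => //; rewrite Ioo mulry gtr0_sg ?mul1e ?leey//.
  by rewrite divr_gt0.
(* A zero integral leaves the factor 2 without slack; there f vanishes almost everywhere on O, hence
   at some point since O is not null. *)
have [I_eq0|I_neq0] := eqVneq (\int[mu]_(x in O) f x) 0.
  apply: contrapT => nf; have : ae_eq mu O f (cst 0).
    apply/(ae_eq_integral_abs mu mO) => //.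
    by under eq_integral => x /[!inE] Ox do rewrite gee0_abs ?f0//.
  move=> [N [mN N0 ON]]; move: muO_gt0; rewrite ltNge => /negP; apply.
  rewrite -N0; apply: le_measure; rewrite ?inE// => x Ox; apply: ON => fx.
  by apply: nf; exists x => //; rewrite fx// I_eq0 mule0.
apply: contrapT => nf.
have fI x : O x -> (2 / fine (mu O))%:E * \int[mu]_(x in O) f x <= f x.
  move=> Ox; rewrite leNgt; apply/negP => fx.
  by apply: nf; exists x => //; exact: ltW.
have Ifin : \int[mu]_(x in O) f x \is a fin_num by rewrite ge0_fin_numE// ltey.
have : \int[mu]_(x in O) cst ((2 / fine (mu O))%:E * \int[mu]_(x in O) f x) x
    <= \int[mu]_(x in O) f x.
  apply: ge0_le_integral => //.
  by move=> x _; rewrite mule_ge0// lee_fin divr_ge0// ltW.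
rewrite integral_cst// -[X in _ * X <= _]fineK// -[X in _ * X * _ <= _]fineK//.
rewrite -[X in _ <= X]fineK// -!EFinM lee_fin.
rewrite mulrAC divfK ?gt_eqF// leNgt ltr_pMl ?ltr1n// fine_gt0//.
by rewrite lt_neqAle eq_sym I_neq0 I0 ltey.
Qed.

(** The constant is a value v x0, not the mean of v, so no integrability of v enters: x0 is a point
    where the inner integral is at most twice its average over O. *)
Lemma mass_centered_le (v : T -> R) : measurable_fun setT v -> exists c,
  mass mu O (fun x => v x - c)%R <= (2 / fine (mu O))%:E *
    \int[mu]_(x in O) \int[mu]_(y in O) ((v x - v y) ^+ 2)%:E.
Proof.
move=> mv.
have [|x _|x0 _ H] :=
  @exists_le_average (fun x => \int[mu]_(y in O) ((v x - v y) ^+ 2)%:E).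
(* Written as a Tonelli section integral, the inner integral is measurable in x. *)
- pose h (z : T * T) := (jump v z ^+ 2 * \1_O z.2)%:E.
  have -> : (fun x => \int[mu]_(y in O) ((v x - v y) ^+ 2)%:E) = fubini_F mu h.
    apply/funext => x; rewrite integral_mkcond; apply: eq_integral => y _.
    rewrite patchE /h /= indicE; case: ifP => _; first by rewrite mulr1.
    by rewrite mulr0.
  apply: (measurable_funS measurableT) => //.
  apply: measurable_fun_fubini_tonelli_F.
    apply/measurable_EFinP; apply: measurable_funM.
      by apply: measurable_funX; exact: measurable_jump.
    have m1 : measurable_fun setT (\1_O : T -> R) by exact: measurable_indic.
    exact: (measurableT_comp m1 measurable_snd).
  by move=> z; rewrite lee_fin mulr_ge0 ?sqr_ge0// indicE.
- by apply: integral_ge0 => y _; rewrite lee_fin sqr_ge0.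
exists (v x0); apply: le_trans H; rewrite /mass /weighted_sqr.
rewrite le_eqVlt; apply/orP; left; apply/eqP; apply: eq_integral => y _.
by rewrite /= mulr1 -sqrrN opprB.
Qed.

End averaging.

(** * Lebesgue measure on row vectors and its products *)

(** Covers are indexed by countable sets of boxes, measures by sequences; the indices not hit by [f]
    receive the empty set. *)
Lemma countable_bigcup_seq (T I : Type) (D : set I) (F : I -> set T) :
  countable D -> exists (f : I -> nat) (G : nat -> set T),
  [/\ {in D &, injective f}, \bigcup_(i in D) F i = \bigcup_k G k,
      forall i, D i -> G (f i) = F i &
      forall k, (f @` D) k \/ G k = set0].
Proof.
move=> /countable_injP[f finj]; exists f.
exists (fun k => \bigcup_(i in [set i | D i /\ f i = k]) F i); split => //.
- apply/seteqP; split=> [x [i Di Fix]|x [k _ [i [Di _] Fix]]]; last by exists i.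
  by exists (f i) => //; exists i.
- move=> i Di; apply/seteqP; split=> [x [j [Dj fji]]|x Fix]; last by exists i.
  by have -> : j = i by apply: finj; rewrite ?inE.
move=> k; have [fDk|nfDk] := pselect ((f @` D) k); first by left.
by right; rewrite -subset0 => x [i [Di fik] _]; apply: nfDk; exists i.
Qed.

Lemma countable_bigcup_measurable d (T : sigmaRingType d) (I : Type)
    (D : set I) (F : I -> set T) : countable D ->
  (forall i, D i -> measurable (F i)) -> measurable (\bigcup_(i in D) F i).
Proof.
move=> /countable_bigcup_seq-/(_ _ F)[f [G [_ -> Gf G0]]] mF.
by apply: bigcupT_measurable => k; have [[i Di <-]|->//] := G0 k;
  rewrite Gf//; exact: mF.
Qed.

(** Subadditivity is asked only of sequences made of the given sets and the empty set, so that it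
    applies both to the outer measure and to a measure, whose subadditivity concerns measurable
    sets. *)
Lemma countable_subadditive (R : realType) (T : Type) (I : choiceType)
    (nu : set T -> \bar R) (D : set I) (F : I -> set T) : countable D ->
  (forall A, 0 <= nu A)%E -> nu set0 = 0%E ->
  (forall G : nat -> set T,
    (forall k, G k = set0 \/ exists2 i, D i & G k = F i) ->
    (nu (\bigcup_k G k) <= \sum_(k <oo) nu (G k))%E) ->
  (nu (\bigcup_(i in D) F i) <= \esum_(i in D) nu (F i))%E.
Proof.
move=> /countable_bigcup_seq-/(_ _ F)[f [G [finj -> Gf G0]]] nu_ge0 nu0 nu_sub.
apply: (le_trans (nu_sub _ _)) => [k|].
  by have [[i Di <-]|->] := G0 k; [right; exists i => //; exact: Gf|left].
rewrite nneseries_esumT//.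
have -> : \esum_(k in [set: nat]) nu (G k) = \esum_(k in f @` D) nu (G k).
  rewrite [RHS]esum_mkcond; apply: eq_esum => k _.
  by case: ifPn => //; rewrite notin_setE; have [//|->] := G0 k.
by rewrite esum_image//; apply: le_esum => i Di; rewrite Gf.
Qed.

Lemma max0_subr_split (R : realDomainType) (a b c : R) :
  Num.max 0 (b - a) =
  Num.max 0 (Num.min b c - a) + Num.max 0 (b - Num.max a c).
Proof.
have [bc|cb] := leP b c; have [ac|ca] := leP a c.
- by rewrite [Num.max 0 (b - c)]max_l ?addr0// subr_le0.
- by rewrite max_l ?addr0// subr_le0 (le_trans bc)// ltW.
- rewrite !max_r ?subr_ge0 ?(ltW cb)// ?(le_trans ac (ltW cb))//.
  by ring.
- by rewrite [Num.max 0 (c - a)]max_l ?add0r// subr_le0 ltW.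
Qed.

Section lebesgue_boxes.
Context (R : realType).
Local Open Scope ereal_scope.

Lemma lebesgue_outer_box_le n (p : 'rV[R]_n * 'rV[R]_n) :
  lebesgue_outer (box p) <= (box_vol p)%:E.
Proof.
rewrite -(@esum_set1 _ _ p (fun p => (box_vol p)%:E)) ?box_vol_ge0//.
by apply: ereal_inf_lbound; exists [set p] => //; split => // x px; exists p.
Qed.

Lemma lebesgue_outer_esum_box_le n (I : choiceType) (D : set I)
    (q : I -> 'rV[R]_n * 'rV[R]_n) (A : set 'rV[R]_n) : countable D ->
  A `<=` \bigcup_(i in D) box (q i) ->
  lebesgue_outer A <= \esum_(i in D) (box_vol (q i))%:E.
Proof.
move=> cD AD; apply: (le_trans (le_lebesgue_outer AD)).
apply: (@le_trans _ _ (\esum_(i in D) lebesgue_outer (box (q i)))).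
  apply: countable_subadditive => //.
  - exact: lebesgue_outer_ge0.
  - by move=> G _; exact: lebesgue_outer_sigma_subadditive.
by apply: le_esum => i _; exact: lebesgue_outer_box_le.
Qed.

Definition box_below n (i : 'I_n) (c : R) (p : 'rV[R]_n * 'rV[R]_n) :=
  (p.1, \row_j if j == i then Num.min (p.2 0%R i) c else p.2 0%R j).

Definition box_above n (i : 'I_n) (c : R) (p : 'rV[R]_n * 'rV[R]_n) :=
  (\row_j (if j == i then Num.max (p.1 0%R i) c else p.1 0%R j), p.2).

Lemma box_vol_split n (i : 'I_n) (c : R) (p : 'rV[R]_n * 'rV[R]_n) :
  box_vol p = (box_vol (box_below i c p) + box_vol (box_above i c p))%R.
Proof.
have volE q : box_vol q = (Num.max 0 (q.2 0 i - q.1 0 i) *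
    \prod_(j < n | j != i) Num.max 0 (q.2 0 j - q.1 0 j))%R.
  by rewrite /box_vol (bigD1 i).
rewrite !volE /= !mxE !eqxx (max0_subr_split _ _ c) mulrDl.
congr (_ * _ + _ * _)%R; apply: eq_bigr => j /negbTE ji; by rewrite mxE ji.
Qed.

(* Each box of a cover is cut by x_i = c into two closed boxes with the same
   total volume. *)
Lemma caratheodory_halfspace n (i : 'I_n) (c : R) :
  (@lebesgue_outer R n).-caratheodory [set x : 'rV[R]_n | x 0%R i <= c]%R.
Proof.
apply: le_caratheodory_measurable => X.
apply: le_ereal_inf_tmp => _ [D [cD XD] <-].
set H := [set x | _].
apply: (@le_trans _ _ (\esum_(p in D) (box_vol (box_below i c p))%:E +
    \esum_(p in D) (box_vol (box_above i c p))%:E)).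
  apply: leeD; apply: lebesgue_outer_esum_box_le => //.
    move=> x [/XD[p Dp px] Hx]; exists p => // j; rewrite mxE.
    have /andP[pj jp] := px j; have /andP[_ ip] := px i.
    case: eqP => [->|_]; last by rewrite pj jp.
    by have /andP[-> _] := px i; rewrite le_min ip.
  move=> x [/XD[p Dp px] /negP Hx]; exists p => // j; rewrite mxE.
  have /andP[pj jp] := px j; have /andP[ip _] := px i.
  case: eqP => [->|_]; last by rewrite pj jp.
  have /andP[_ ->] := px i; rewrite andbT ge_max ip/=.
  by rewrite ltW// ltNge.
rewrite -esumD; [|by move=> p _; exact: box_vol_ge0..].
by apply: le_esum => p _; rewrite -EFinD -box_vol_split.
Qed.

Lemma measurable_coord n (i : 'I_n) :
  measurable_fun setT (fun x : lebesgue_space R n => (x : 'rV[R]_n) 0%R i).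
Proof.
apply: (measurability _ (RGenOInfty.measurableE R)) => _ [_ [c ->] <-].
rewrite setTI (_ : _ @^-1` _ = ~` [set x : 'rV[R]_n | x 0%R i <= c]%R).
  exact/caratheodory_measurable_setC/caratheodory_halfspace.
by apply/seteqP; split => x /=; rewrite in_itv/= andbT ltNge => /negP.
Qed.

Lemma measurable_box n (p : 'rV[R]_n * 'rV[R]_n) :
  measurable (box p : set (lebesgue_space R n)).
Proof.
have -> : box p = \bigcap_(i in [set: 'I_n])
    ((fun x : 'rV[R]_n => x 0%R i) @^-1` `[p.1 0%R i, p.2 0%R i]).
  apply/seteqP; split => [x px i _ /=|x px i]; first by rewrite in_itv/= px.
  by have /= := px i Logic.I; rewrite in_itv.
apply: fin_bigcap_measurable => // i _; rewrite -[X in measurable X]setTI.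
exact: measurable_coord.
Qed.

Lemma measurable_open n (U : set 'rV[R]_n) :
  open U -> measurable (U : set (lebesgue_space R n)).
Proof.
move=> oU; pose q (a : 'rV[rat]_n * nat) : 'rV[R]_n * 'rV[R]_n :=
  (\row_i (ratr (a.1 0 i) - a.2.+1%:R^-1),
   \row_i (ratr (a.1 0 i) + a.2.+1%:R^-1))%R.
have -> : U = \bigcup_a [set x | box (q a) x /\ box (q a) `<=` U].
  apply/seteqP; split => [x Ux|x [a _ [qx]]]; last exact.
  have /nbhs_ballP[e /= e0 xeU] : nbhs x U by exact: open_nbhs_nbhs.
  (* The rational centre lies within [dl] of x and the box has half-width [dl], so its points are
     within 2 * dl < e of x. *)
  have [k ke] : exists k, (k.+1%:R^-1 < e / 2)%R.
    have e20 : (0 < e / 2)%R by rewrite divr_gt0.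
    near \oo => k; exists k; near: k.
    by apply: (cvgr_lt _ (@cvg_harmonic R)).
  have : (0 < k.+1%:R^-1 :> R)%R by rewrite invr_gt0.
  have [dl dlE] : exists dl : R, dl = (k.+1%:R^-1)%R by exists (k.+1%:R^-1)%R.
  rewrite -dlE in ke *; move=> dl0.
  have /choice[r Hr] : forall i, exists r : rat,
      ratr r \in `]x 0%R i - dl, x 0%R i + dl[%R.
    by move=> i; apply: rat_in_itvoo; lra.
  have xr i : (x 0%R i - dl < ratr (r i) < x 0%R i + dl)%R.
    by have := Hr i; rewrite in_itv.
  exists (\row_i r i, k) => //; split => [i|y qy].
    rewrite !mxE/= -dlE; have /andP[? ?] := xr i.
    by apply/andP; split; lra.
  apply: xeU; split => // i j; rewrite (ord1 i).
  have := qy j; rewrite !mxE/= -dlE => /andP[? ?]; have /andP[? ?] := xr j.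
  by rewrite /ball/= ltr_norml; apply/andP; split; lra.
apply: countable_bigcupT_measurable => // a.
have [aU|aU] := pselect (box (q a) `<=` U).
  rewrite (_ : [set x | _] = box (q a)); first exact: measurable_box.
  by apply/seteqP; split => [x []|x qx].
by rewrite (_ : [set x | _] = set0)// -subset0 => x [].
Unshelve. all: by end_near. Qed.

Definition cube n (m : nat) : 'rV[R]_n * 'rV[R]_n :=
  (const_mx (- m%:R)%R, const_mx m%:R).

Lemma bounded_sub_cube n (A : set 'rV[R]_n) : bounded_set A ->
  exists m, A `<=` box (cube n m).
Proof.
move=> [M [Mreal HM]]; exists (Num.truncn (`|M| + 1)).+1 => x Ax i.
rewrite !mxE -ler_norml.
have Mx : (`|x| <= `|M| + 1)%R.
  by apply: HM Ax; rewrite (le_lt_trans (ler_norm _))// ltrDl.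
rewrite (@le_trans _ _ `|x|%R)//.
  rewrite /Num.norm/= mx_normrE.
  exact: (le_bigmax _ (fun ij => `|x ij.1 ij.2|%R) (0%R, i)).
by rewrite (le_trans Mx)// ltW// truncnS_gt.
Qed.

Lemma bigcup_cube n : \bigcup_m box (cube n m) = setT.
Proof.
apply/seteqP; split => // x _.
have [|m] := @bounded_sub_cube _ [set x].
  exists `|x|%R; split => [|M xM y ->]; [exact: normr_real|exact: ltW].
by move=> /(_ x erefl); exists m.
Qed.

Lemma lebesgue_sigma_finite n : sigma_finite setT (lebesgue_rV R n).
Proof.
exists (fun m => box (cube n m)); first by rewrite bigcup_cube.
move=> m; split; first exact: measurable_box.
exact: le_lt_trans (lebesgue_outer_box_le _) (ltry _).
Qed.

HB.instance Definition _ n := Measure_isSigmaFinite.Build _ _ _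
  (lebesgue_rV R n) (lebesgue_sigma_finite n).

End lebesgue_boxes.

(** * Lebesgue measure on R^(n+m) and the product measure *)

Section lebesgue_product.
Context (R : realType) (n m : nat).
Local Notation lambda := (lebesgue_rV R).
Local Notation M := (lambda n \x lambda m)%E.
Local Notation T := (lebesgue_space R n * lebesgue_space R m)%type.
Local Open Scope ereal_scope.

Definition pair_row (z : T) : lebesgue_space R (n + m) :=
  row_mx (z.1 : 'rV[R]_n) (z.2 : 'rV[R]_m).

Lemma preimage_pair_row_box (p : 'rV[R]_(n + m) * 'rV[R]_(n + m)) :
  pair_row @^-1` (box p) =
  box (lsubmx p.1, lsubmx p.2) `*` box (rsubmx p.1, rsubmx p.2).
Proof.
apply/seteqP; split => [[x y] xyp|[x y] [/= xp yp] i].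
  split => i /=; rewrite !mxE.
    by have := xyp (lshift m i); rewrite /= row_mxEl.
  by have := xyp (rshift n i); rewrite /= row_mxEr.
rewrite -(splitK i); case: (fintype.split i) => j /=.
  by have := xp j; rewrite /pair_row row_mxEl /= !mxE.
by have := yp j; rewrite /pair_row row_mxEr /= !mxE.
Qed.

Lemma measurable_preimage_pair_row_box p :
  measurable (pair_row @^-1` (box p)).
Proof.
rewrite preimage_pair_row_box.
by apply: measurableX; exact: measurable_box.
Qed.

Lemma product_measure_box_le p : M (pair_row @^-1` (box p)) <= (box_vol p)%:E.
Proof.
rewrite preimage_pair_row_box product_measure1E; [|exact: measurable_box..].
apply: (@le_trans _ _ ((box_vol (lsubmx p.1, lsubmx p.2))%:E *
    (box_vol (rsubmx p.1, rsubmx p.2))%:E)).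
  apply: lee_pmul; [exact: measure_ge0|exact: measure_ge0| |];
    exact: lebesgue_outer_box_le.
rewrite -EFinM lee_fin /box_vol big_split_ord/=.
by rewrite le_eqVlt; apply/orP; left; apply/eqP; congr (_ * _)%R;
  apply: eq_bigr => i _; rewrite !mxE.
Qed.

Lemma lebesgue_outer_cover k (A : set 'rV[R]_k) (e : R) :
  lebesgue_outer A < +oo -> (0 < e)%R ->
  exists D : set ('rV[R]_k * 'rV[R]_k), [/\ countable D,
    A `<=` \bigcup_(p in D) box p &
    \esum_(p in D) (box_vol p)%:E <= lebesgue_outer A + e%:E].
Proof.
move=> Aoo e0; have Afin : lebesgue_outer A \is a fin_num.
  by rewrite ge0_fin_numE// lebesgue_outer_ge0.
have [_ [D [cD AD] <-] /ltW Dle] := lb_ereal_inf_adherent e0 Afin.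
by exists D.
Qed.

(** A box pulls back to a product of boxes, of product measure at most its volume. Intersecting the
    pulled-back covers of total volume at most 1/(k+1) gives N. *)
Lemma null_cover_pair_row (A : set 'rV[R]_(n + m)) : lebesgue_outer A = 0 ->
  exists N : set T, [/\ measurable N, M N = 0 & pair_row @^-1` A `<=` N].
Proof.
move=> A0; have /choice[D HD] : forall k : nat,
    exists D : set ('rV[R]_(n + m) * 'rV[R]_(n + m)), [/\ countable D,
    A `<=` \bigcup_(p in D) box p &
    \esum_(p in D) (box_vol p)%:E <= (k.+1%:R^-1)%:E].
  move=> k; have [||D [cD AD Dle]] := @lebesgue_outer_cover _ A k.+1%:R^-1%R.
  - by rewrite A0.
  - by rewrite invr_gt0.
  - by exists D; split => //; rewrite A0 add0e in Dle.
pose U k : set T := \bigcup_(p in D k) (pair_row @^-1` (box p)).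
have mU k : measurable (U k).
  have [cD _ _] := HD k; apply: countable_bigcup_measurable => // p _.
  exact: measurable_preimage_pair_row_box.
exists (\bigcap_k U k); split; first exact: bigcapT_measurable.
  apply/eqP; rewrite eq_le measure_ge0 andbT.
  apply/lee_addgt0Pr => e e0; rewrite add0e.
  have [k ke] : exists k, (k.+1%:R^-1 < e)%R.
    near \oo => k; exists k; near: k.
    by apply: (cvgr_lt _ (@cvg_harmonic R)).
  apply: (@le_trans _ _ (M (U k))).
    apply: le_measure; rewrite ?inE//; first exact: bigcapT_measurable.
    by move=> z; apply.
  have [cD _ Dle] := HD k.
  apply: (@le_trans _ _ (\esum_(p in D k) (box_vol p)%:E)); last first.
    by rewrite (le_trans Dle)// lee_fin ltW.
  apply: (@le_trans _ _ (\esum_(p in D k) M (pair_row @^-1` (box p)))).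
    apply: countable_subadditive => // G HG.
    have mG j : measurable (G j).
      have [->|[p _ ->]] := HG j => //.
      exact: measurable_preimage_pair_row_box.
    by apply: measure_sigma_subadditive => //; exact: bigcupT_measurable.
  by apply: le_esum => p _; exact: product_measure_box_le.
move=> z Az k _; have [_ AD _] := HD k.
by have [p Dp zp] := AD _ Az; exists p.
Unshelve. all: by end_near. Qed.

(** A lies in a countable intersection of box covers with the same finite measure. The difference is
    null, so its preimage sits in some N; off N the preimage of A is that of the intersection, which
    is product measurable. *)
Let measurable_modulo_null_finite (A : set (lebesgue_space R (n + m))) :
  measurable A -> lambda (n + m)%N A < +oo ->
  exists N : set T, [/\ measurable N, M N = 0 &
    measurable (pair_row @^-1` A `\` N)].
Proof.
move=> mA Aoo; have /choice[D HD] : forall k : nat,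
    exists D : set ('rV[R]_(n + m) * 'rV[R]_(n + m)), [/\ countable D,
    A `<=` \bigcup_(p in D) box p &
    \esum_(p in D) (box_vol p)%:E <= lebesgue_outer A + (k.+1%:R^-1)%:E].
  by move=> k; apply: lebesgue_outer_cover => //; rewrite invr_gt0.
pose U k : set (lebesgue_space R (n + m)) := \bigcup_(p in D k) (box p).
have mU k : measurable (U k).
  have [cD _ _] := HD k; apply: countable_bigcup_measurable => // p _.
  exact: measurable_box.
have mcapU : measurable (\bigcap_k U k) by exact: bigcapT_measurable.
have AU : A `<=` \bigcap_k U k by move=> x Ax k _; have [_ /(_ _ Ax)] := HD k.
have capU_le : lambda _ (\bigcap_k U k) <= lambda _ A.
  apply/lee_addgt0Pr => e e0.
  have [k ke] : exists k, (k.+1%:R^-1 < e)%R.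
    near \oo => k; exists k; near: k.
    by apply: (cvgr_lt _ (@cvg_harmonic R)).
  have [cD _ Dle] := HD k.
  apply: (@le_trans _ _ (\esum_(p in D k) (box_vol p)%:E)).
    by apply: lebesgue_outer_esum_box_le => // x; apply.
  by rewrite (le_trans Dle)// leeD2l// lee_fin ltW.
have capUE : lambda _ (\bigcap_k U k) = lambda _ A.
  by apply/eqP; rewrite eq_le capU_le/=; apply: le_measure; rewrite ?inE.
have UA0 : lebesgue_outer (\bigcap_k U k `\` A) = 0.
  have -> : lebesgue_outer (\bigcap_k U k `\` A) =
      lambda _ (\bigcap_k U k `\` A) by [].
  rewrite measureD//; last exact: le_lt_trans Aoo.
  transitivity (lambda _ (\bigcap_k U k) - lambda _ A).
    by congr (_ - lambda _ _); exact: setIidr.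
  by rewrite capUE subee// ge0_fin_numE.
have [N [mN N0 UAN]] := null_cover_pair_row UA0.
exists N; split => //.
have -> : pair_row @^-1` A `\` N =
    (\bigcap_k \bigcup_(p in D k) (pair_row @^-1` (box p))) `\` N.
  apply/seteqP; split => [z [Az Nz]|z [Uz Nz]]; split => //.
    by move=> k _; exact: (AU _ Az k Logic.I).
  by apply: contrapT => nAz; apply/Nz/UAN; split => // k _; exact: (Uz k).
apply: measurableD => //; apply: bigcapT_measurable => k.
have [cD _ _] := HD k; apply: countable_bigcup_measurable => // p _.
exact: measurable_preimage_pair_row_box.
Unshelve. all: by end_near. Qed.

Let bigcup_null (N : nat -> set T) : (forall k, measurable (N k)) ->
  (forall k, M (N k) = 0) -> M (\bigcup_k N k) = 0.
Proof.
move=> mN N0; apply/negligibleP; first exact: bigcupT_measurable.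
apply: negligible_bigcup => k.
by apply/negligibleP; [exact: mN|exact: N0].
Qed.

Lemma measurable_modulo_null (A : set (lebesgue_space R (n + m))) :
  measurable A -> exists N : set T, [/\ measurable N, M N = 0 &
    measurable (pair_row @^-1` A `\` N)].
Proof.
move=> mA; have /choice[N HN] : forall k : nat, exists N : set T,
    [/\ measurable N, M N = 0 &
    measurable (pair_row @^-1` (A `&` box (cube R (n + m) k)) `\` N)].
  move=> k; apply: measurable_modulo_null_finite.
    by apply: measurableI => //; exact: measurable_box.
  apply: le_lt_trans (ltry (box_vol (cube R (n + m) k))).
  apply: le_trans (lebesgue_outer_box_le _).
  by apply: le_lebesgue_outer => x [].
have mN k : measurable (N k) by have [] := HN k.
have N0 k : M (N k) = 0 by have [] := HN k.
exists (\bigcup_k N k); split; [exact: bigcupT_measurable|exact: bigcup_null|].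
have -> : pair_row @^-1` A `\` \bigcup_k N k =
    (\bigcup_k (pair_row @^-1` (A `&` box (cube R (n + m) k)) `\` N k))
    `\` \bigcup_k N k.
  apply/seteqP; split => [z [Az Nz]|z [[k _ [[Az _] _]]] Nz]; split => //.
  have [k _ zk] : (\bigcup_k box (cube R (n + m) k)) (pair_row z).
    by rewrite bigcup_cube.
  by exists k => //; split => // Nkz; apply: Nz; exists k.
apply: measurableD; last exact: bigcupT_measurable.
by apply: bigcupT_measurable => k; have [] := HN k.
Qed.

Lemma measurable_fun_modulo_null (g : lebesgue_space R (n + m) -> R) :
  measurable_fun setT g -> exists N : set T, [/\ measurable N, M N = 0 &
    measurable_fun (~` N) (g \o pair_row)].
Proof.
(* [q] enumerates the rationals, with 0 for codes that decode to nothing. Rational levels keep the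
   number of null sets countable; a real level c is reached through the rationals above it. *)
move=> mg; pose q (k : nat) : R := ratr (odflt 0%R (unpickle k)).
have /choice[N HN] : forall k : nat, exists N : set T,
    [/\ measurable N, M N = 0 &
    measurable (pair_row @^-1` (g @^-1` `]q k, +oo[) `\` N)].
  move=> k; apply: measurable_modulo_null.
  by rewrite -[X in measurable X]setTI; exact: mg.
have mN k : measurable (N k) by have [] := HN k.
have N0 k : M (N k) = 0 by have [] := HN k.
have mNN : measurable (\bigcup_k N k) by exact: bigcupT_measurable.
exists (\bigcup_k N k); split => //; first exact: bigcup_null.
apply: (measurability _ (RGenOInfty.measurableE R)) => _ [_ [c ->] <-].
rewrite (_ : _ `&` _ = (\bigcup_(k in [set k | c < q k]%R)
    (pair_row @^-1` (g @^-1` `]q k, +oo[) `\` N k)) `\` \bigcup_k N k).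
  apply: measurableD => //.
  by apply: bigcup_measurable => k _; have [] := HN k.
apply/seteqP; split => [z [Nz]|z [[k /= ck [gz Nkz]] Nz]]; last first.
  by split => //=; move: gz; rewrite /= !in_itv/= !andbT; exact: lt_trans.
rewrite /= in_itv/= andbT => cgz; split => //.
have [r] := rat_in_itvoo cgz; rewrite in_itv/= => /andP[cr rg].
have qr : q (pickle r) = ratr r by rewrite /q pickleK.
exists (pickle r); first by rewrite /= qr.
split; first by rewrite /= in_itv/= andbT qr.
by move=> Nrz; apply: Nz; exists (pickle r).
Qed.

End lebesgue_product.

(** * Iterated integrals of functions with a product-measurable version *)

Section iterated_integral.
Context d (T : measurableType d) (R : realType)
  (mu : {sigma_finite_measure set T -> \bar R}).
Hypothesis mu_complete : measure_is_complete mu.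
Local Notation M := (mu \x mu)%E.
Local Open Scope ereal_scope.

(** On a complete measure space [f] inherits measurability from [g]. *)
Lemma ae_eq_integral_complete (D : set T) (f g : T -> \bar R) : measurable D ->
  measurable_fun D g -> {ae mu, forall x, D x -> f x = g x} ->
  \int[mu]_(x in D) f x = \int[mu]_(x in D) g x.
Proof.
move=> mD mg fg; have gf : ae_eq mu D g f.
  by apply: filterS fg => x fg Dx; rewrite fg.
by apply/esym/(ae_eq_integral _ _ mD mg) => //; exact: ae_measurable_fun gf mg.
Qed.

Lemma integral_null_set (D : set T) (f : T -> \bar R) : measurable D ->
  mu D = 0 -> \int[mu]_(x in D) f x = 0.
Proof.
move=> mD D0; rewrite (@ae_eq_integral_complete _ _ (cst 0)) ?integral0//.
by exists D; split => // x /= nDx; apply: contrapT => nD; apply: nDx => /nD.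
Qed.

Variables (O D : set T) (h h' : T -> T -> R).
Hypotheses (mO : measurable O) (mD : measurable D).
Hypothesis mh' : measurable_fun setT (fun z => h' z.1 z.2).
Hypothesis hh' :
  {ae mu, forall x, O x -> {ae mu, forall y, D y -> h x y = h' x y}}.

Let H z := (h' z.1 z.2 * (\1_O z.1 * \1_D z.2))%:E.

Let measurable_indicX : measurable_fun setT
  (fun z : T * T => \1_O z.1 * \1_D z.2 : R)%R.
Proof.
have m1 A : measurable A -> measurable_fun setT (\1_A : T -> R).
  by move=> mA; exact: measurable_indic.
by apply: measurable_funM; [exact: (measurableT_comp (m1 _ mO))|
  exact: (measurableT_comp (m1 _ mD))].
Qed.

Let mH : measurable_fun setT H.
Proof. by apply/measurable_EFinP; exact: measurable_funM. Qed.

(** Completeness is used twice: in y, for almost every x, to replace [h x] by [h' x], then in x to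
    replace the inner integrals. The measurability premise comes from Tonelli or from integrability
    below. *)
Let integral_fubini_F : measurable_fun setT (fubini_F mu H) ->
  \int[mu]_(x in O) \int[mu]_(y in D) (h x y)%:E = \int[mu]_x fubini_F mu H x.
Proof.
move=> mF; transitivity (\int[mu]_(x in O) fubini_F mu H x).
  apply: ae_eq_integral_complete => //; first exact: measurable_funS mF.
  apply: filterS hh' => x hx Ox.
  rewrite (@ae_eq_integral_complete _ _ (fun y => (h' x y)%:E))//.
  - rewrite integral_mkcond; apply: eq_integral => y _.
    rewrite patchE /H/= !indicE (mem_set Ox) mulr1n mul1r.
    by case: ifP => _; rewrite ?mulr1n ?mulr0n ?mulr1 ?mulr0.
  - apply/measurable_EFinP/(measurable_funS measurableT) => //.
    exact: (measurableT_comp mh' (pair1_measurable x)).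
  - by apply: filterS (hx Ox) => y + Dy => ->.
rewrite integral_mkcond; apply: eq_integral => x _; rewrite patchE.
case: ifPn => // xO; apply/esym/integral0_eq => y _.
by rewrite /H/= [\1_O x]indicE (negbTE xO) mul0r mulr0.
Qed.

Lemma ge0_iterated_integralE : (forall x y, 0 <= h' x y)%R ->
  \int[mu]_(x in O) \int[mu]_(y in D) (h x y)%:E = \int[M]_z H z.
Proof.
move=> h'0; have H0 z : 0 <= H z.
  by rewrite lee_fin mulr_ge0 ?h'0// mulr_ge0 ?indicE.
rewrite integral_fubini_F; last exact: measurable_fun_fubini_tonelli_F.
by rewrite fubini_tonelli1.
Qed.

Lemma iterated_integralE : M.-integrable setT H ->
  \int[mu]_(x in O) \int[mu]_(y in D) (h x y)%:E = \int[M]_z H z.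
Proof.
move=> intH; rewrite integral_fubini_F; last exact: (measurable_fubini_F intH).
exact: (integral12_prod_meas1 intH).
Qed.

End iterated_integral.

Section joint_kernel.
Context (R : realType) (d : nat) (gamma : 'rV[R]_d -> 'rV[R]_d -> R).
Local Notation T := (lebesgue_space R d).
Local Notation mu := (lebesgue_rV R d).
Hypothesis gamma_ge0 : forall x y, 0 <= gamma x y.
Hypothesis gamma_measurable : jointly_measurable gamma.

Lemma lebesgue_complete : measure_is_complete mu.
Proof. exact: measure_is_complete_caratheodory. Qed.

(* A Lebesgue measurable kernel need not be measurable for the product
   sigma-algebra; it is, after being set to 0 on a null set. *)
Lemma product_measurable_version : exists k : T * T -> R,
  [/\ measurable_fun setT k, forall z, 0 <= k z,
      {ae mu, forall x, {ae mu, forall y, gamma y x = k (x, y)}} &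
      {ae mu, forall y, {ae mu, forall x, gamma y x = k (x, y)}}].
Proof.
have [N [mN N0 gN]] := measurable_fun_modulo_null gamma_measurable.
pose g z := gamma (lsubmx z) (rsubmx z).
pose k1 := (g \o @pair_row R d d) \_ (~` N).
have mk1 : measurable_fun setT k1.
  exact: (measurable_restrictT _ (measurableC mN)).1 gN.
have k1E x y : ~ N (x, y) -> k1 (x, y) = gamma x y.
  move=> Nxy; rewrite /k1 patchE mem_set//= /g /pair_row/=.
  by rewrite row_mxKl row_mxKr.
have aeN : {ae (mu \x mu)%E, forall z, ~ N z}.
  by exists N; split => // z /contrapT.
(* The swap matches the order gamma(y,x) of the problem, so the sections of N are exchanged as
   well. *)
exists (k1 \o unstable.swap); split.
- exact: (measurableT_comp mk1 (@measurable_swap _ _ T T)).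
- by move=> z; rewrite /k1/= patchE; case: ifP => _ //=; exact: gamma_ge0.
- apply: filterS (ae_prod_ysection aeN) => x; apply: filterS => y Nyx.
  by rewrite /= k1E.
- apply: filterS (ae_prod_xsection aeN) => x; apply: filterS => y Nyx.
  by rewrite /= k1E.
Qed.

End joint_kernel.

(** * The nonlocal Neumann problem *)

#[local] Instance ae_lebesgue_filter (R : realType) (n : nat) :
  Filter (almost_everywhere (lebesgue_rV R n)).
Proof. exact: ae_filter_ringOfSetsType. Qed.

Section neumann_form.
Context (R : realType) (d : nat) (Omega : set 'rV[R]_d)
  (gamma : 'rV[R]_d -> 'rV[R]_d -> R).
Local Notation T := (lebesgue_space R d).
Local Notation mu := (lebesgue_rV R d).
Local Notation M := (mu \x mu)%E.
Local Notation Gamma := (interaction_domain Omega gamma).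
Hypothesis mOmega : measurable (Omega : set T).
Hypothesis gamma_ge0 : forall x y, 0 <= gamma x y.
Variable k0 : T * T -> R.
Hypothesis mk0 : measurable_fun setT k0.
Hypothesis k0_ge0 : forall z, 0 <= k0 z.
Hypothesis k0_ysection :
  {ae mu, forall x, {ae mu, forall y, gamma y x = k0 (x, y)}}.
Hypothesis k0_xsection :
  {ae mu, forall y, {ae mu, forall x, gamma y x = k0 (x, y)}}.
Implicit Types u v : 'rV[R]_d -> R.

Let mindic (A : set T) : measurable A -> measurable_fun setT (\1_A : T -> R).
Proof. by move=> mA; exact: measurable_indic. Qed.

Let mindic1 (A : set T) : measurable A ->
  measurable_fun setT (fun z : T * T => \1_A z.1 : R).
Proof. by move=> mA; exact: (measurableT_comp (mindic mA)). Qed.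

Let mindic2 (A : set T) : measurable A ->
  measurable_fun setT (fun z : T * T => \1_A z.2 : R).
Proof. by move=> mA; exact: (measurableT_comp (mindic mA)). Qed.

Let h (z : T * T) := (k0 z * \1_Omega z.1)%:E.

Let h_ge0 z : (0 <= h z)%E.
Proof. by rewrite lee_fin mulr_ge0// indicE. Qed.

Let mh : measurable_fun setT h.
Proof.
by apply/measurable_EFinP; apply: measurable_funM => //; exact: mindic1.
Qed.

Let exposure_ae : {ae mu, forall y : T,
  (\int[mu]_(x in Omega) (gamma y x)%:E = fubini_G mu h y)%E}.
Proof.
apply: filterS k0_xsection => y yk0.
rewrite (ae_eq_integral_complete (@lebesgue_complete R d)
  (g := fun x => (k0 (x, y))%:E))//.
- rewrite integral_mkcond; apply: eq_integral => x _.
  by rewrite patchE /h indicE; case: ifP; rewrite ?mulr1 ?mulr0.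
- apply/measurable_EFinP/(measurable_funS measurableT) => //.
  exact: (measurableT_comp mk0 (@pair2_measurable _ _ T T y)).
- by apply: filterS yk0 => x -> _.
Qed.

(** Gamma is cut out by positivity of the integral of gamma(y,.) over Omega, which equals a Tonelli
    section integral only almost everywhere; completeness makes it measurable all the same. *)
Lemma measurable_interaction_domain : measurable (Gamma : set T).
Proof.
have me : measurable_fun setT
    (fun y : T => \int[mu]_(x in Omega) (gamma y x)%:E)%E.
  apply: (ae_measurable_fun (@lebesgue_complete R d) (f := fubini_G mu h)).
    by apply: filterS exposure_ae => y -> _.
  exact: measurable_fun_fubini_tonelli_G.
rewrite (_ : Gamma = ~` Omega `&`
    (setT `&` (fun y : T => \int[mu]_(x in Omega) (gamma y x)%:E)%E @^-1`
      `]0%E, +oo[)); last first.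
  apply/seteqP; split => [y [Oy y0]|y [Oy [_]]] /=.
    by split => //; split => //=; rewrite in_itv/= andbT.
  by rewrite in_itv/= andbT.
by apply: measurableI; [exact: measurableC|
  apply: me => //; exact: emeasurable_itv].
Qed.

(* The weights turn the two integrals of bilinV into one; see bilinVE. *)
Definition form_kernel (z : T * T) : R :=
  k0 z * (2^-1 * (\1_Omega z.1 * \1_Omega z.2) + \1_Omega z.1 * \1_Gamma z.2).

Local Notation k := form_kernel.
Let mG := measurable_interaction_domain.

Lemma measurable_form_kernel : measurable_fun setT k.
Proof.
apply: measurable_funM => //; apply: measurable_funD.
  apply: measurable_funM => //.
  by apply: measurable_funM; [exact: mindic1|exact: mindic2].
by apply: measurable_funM; [exact: mindic1|exact: mindic2].
Qed.

Lemma form_kernel_ge0 z : 0 <= k z.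
Proof. by rewrite mulr_ge0// addr_ge0// ?mulr_ge0// ?indicE. Qed.

Let indic_OG (y : T) : \1_Omega y * \1_Gamma y = 0 :> R.
Proof.
rewrite !indicE; have [Oy|_] := boolP (y \in Omega); last by rewrite mul0r.
rewrite memNset ?mulr0// => -[nOy _]; apply: nOy.
by rewrite inE in Oy.
Qed.

(** Omega and Gamma are disjoint, so the weight in y, which is 1/2 on Omega and 1 on Gamma, never
    exceeds 1. *)
Lemma form_kernel_le z : k z <= k0 z * \1_Omega z.1.
Proof.
rewrite ler_wpM2l// !indicE.
case: (_ \in Omega); rewrite ?mul0r ?mulr0 ?addr0//.
have := indic_OG z.2; rewrite !indicE.
by case: (z.2 \in Omega); case: (z.2 \in Gamma);
  rewrite /= ?mulr1n ?mulr0n; lra.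
Qed.

Lemma form_kernel_supp z : 0 < k z -> Omega z.1 /\ (Omega `|` Gamma) z.2.
Proof.
rewrite /k !indicE.
have [z1|_] := boolP (z.1 \in Omega); last first.
  by rewrite !mul0r mulr0 addr0 mulr0 ltxx.
have [z2|_] := boolP (z.2 \in Omega).
  by move=> _; split; [exact: set_mem z1|left; exact: set_mem z2].
have [z3|_] := boolP (z.2 \in Gamma).
  by move=> _; split; [exact: set_mem z1|right; exact: set_mem z3].
by rewrite !mulr0 addr0 mulr0 ltxx.
Qed.

Lemma form_kernel_exterior :
  {ae mu, forall y : T, Gamma y -> (0 < \int[mu]_x (k (x, y))%:E)%E}.
Proof.
apply: filterS exposure_ae => y ye Gy; have [nOy] := Gy; rewrite ye.
congr (_ < _)%E; apply: eq_integral => x _; congr EFin; rewrite /k /=.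
by rewrite ![\1__ y]indicE memNset// mem_set// mulr0n mulr1n !mulr0 add0r mulr1.
Qed.

(** For y outside Omega and Gamma the integral of gamma(y,.) over Omega is not positive, by
    definition of Gamma, hence 0; integrating over such y last, by Tonelli, gives a null
    integral. *)
Let outside_ae : {ae M, forall z : T * T,
  ~ (Omega `|` Gamma) z.2 -> k0 z * \1_Omega z.1 = 0}.
Proof.
pose A : set T := ~` (Omega `|` Gamma).
have mA : measurable A by apply/measurableC/measurableU.
have : ae_eq M setT (fun z => h z * (\1_A z.2)%:E)%E (cst 0%E).
  have mhA : measurable_fun setT (fun z => h z * (\1_A z.2)%:E)%E.
    by apply: emeasurable_funM => //; apply/measurable_EFinP; exact: mindic2.
  have hA_ge0 z : (0 <= h z * (\1_A z.2)%:E)%E.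
    by rewrite mule_ge0// lee_fin indicE.
  apply/(ae_eq_integral_abs M measurableT) => //.
  under eq_integral => z _ do rewrite gee0_abs ?hA_ge0//.
  rewrite fubini_tonelli2//.
  rewrite (ae_eq_integral_complete (@lebesgue_complete R d) (g := cst 0%E))//.
    by rewrite integral0.
  apply: filterS exposure_ae => y ye _; rewrite /fubini_G.
  have [yA|yA] := boolP (y \in A); last first.
    by apply: integral0_eq => x _; rewrite /= [\1_A y]indicE (negbTE yA) mule0.
  under eq_integral do rewrite /= [\1_A y]indicE yA mule1.
  rewrite -/(fubini_G mu h y) -ye; apply/eqP; rewrite eq_le.
  rewrite integral_ge0 ?andbT; last by move=> x _; rewrite lee_fin.
  rewrite leNgt; apply/negP => y0; move: yA; rewrite inE; apply.
  by have [Oy|nOy] := pselect (Omega y); [left|right].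
apply: filterS => z /(_ Logic.I) /= hA zA.
move: hA; rewrite [\1_A _]indicE mem_set// mule1 => -[].
exact.
Qed.

Lemma measurable_form_sqr v : rV_measurable_fun setT v ->
  measurable_fun setT (fun z : T * T => jump v z ^+ 2).
Proof. by move=> mv; apply: measurable_funX; exact: (@measurable_jump _ T). Qed.

Lemma energyE v : rV_measurable_fun setT v ->
  energy Omega gamma v =
  (\int[M]_z (jump v z ^+ 2 * (k0 z * \1_Omega z.1))%:E)%E.
Proof.
move=> mv; rewrite /energy.
rewrite (@ge0_iterated_integralE _ _ _ mu (@lebesgue_complete R d) _ setT _
  (fun x y => (v x - v y) ^+ 2 * k0 (x, y)))//.
- apply: eq_integral => -[x y] _ /=; congr EFin.
  by rewrite [\1_setT y]indicE in_setT mulr1 -mulrA.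
- apply: measurable_funM; first exact: measurable_form_sqr.
  by under eq_fun do rewrite -surjective_pairing.
- by apply: filterS k0_ysection => x xk0 _; apply: filterS xk0 => y -> _.
- by move=> x y; rewrite mulr_ge0 ?sqr_ge0.
Qed.

Lemma jump_energy_le_energy v : rV_measurable_fun setT v ->
  (jump_energy mu k v <= energy Omega gamma v)%E.
Proof.
move=> mv; rewrite energyE//; apply: ge0_le_integral => //.
- by move=> z _; rewrite lee_fin mulr_ge0 ?sqr_ge0 ?form_kernel_ge0.
- apply/measurable_EFinP; apply: measurable_funM.
    exact: measurable_form_sqr.
  exact: measurable_form_kernel.
- apply/measurable_EFinP; apply: measurable_funM.
    exact: measurable_form_sqr.
  by apply: measurable_funM => //; exact: mindic1.
- move=> z _; rewrite lee_fin ler_wpM2l ?sqr_ge0//; exact: form_kernel_le.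
Qed.

Lemma energy_le_jump_energy v : rV_measurable_fun setT v ->
  (energy Omega gamma v <= 2%:E * jump_energy mu k v)%E.
Proof.
move=> mv; rewrite energyE//.
have mQ : measurable_fun setT (fun z : T * T => (jump v z ^+ 2 * k z)%:E).
  apply/measurable_EFinP; apply: measurable_funM.
    exact: measurable_form_sqr.
  exact: measurable_form_kernel.
have Q0 (z : T * T) : (0 <= (jump v z ^+ 2 * k z)%:E)%E.
  by rewrite lee_fin mulr_ge0 ?sqr_ge0 ?form_kernel_ge0.
rewrite /jump_energy /weighted_sqr -ge0_integralZl//.
apply: ae_ge0_le_integral => //.
- by move=> z _; rewrite lee_fin mulr_ge0 ?sqr_ge0// mulr_ge0// indicE.
- apply/measurable_EFinP; apply: measurable_funM.
    exact: measurable_form_sqr.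
  by apply: measurable_funM => //; exact: mindic1.
- by move=> z _; rewrite mule_ge0.
- exact: measurable_funeM.
apply: filterS outside_ae => z zout _; rewrite -EFinM lee_fin [leRHS]mulrCA.
rewrite ler_wpM2l ?sqr_ge0//.
(* On the union of Omega and Gamma the weight in y is at least 1/2; elsewhere the left side is 0. *)
have [zOG|/zout ->] := pselect ((Omega `|` Gamma) z.2); last first.
  by rewrite mulr_ge0// form_kernel_ge0.
rewrite /k [leRHS]mulrCA ler_wpM2l// !indicE.
case: (z.1 \in Omega) => /=; rewrite ?mulr1n ?mulr0n; last by lra.
have := indic_OG z.2; rewrite !indicE.
case: zOG => /mem_set ->; last by case: (z.2 \in Omega) => /=; lra.
by case: (z.2 \in Gamma) => /=; lra.
Qed.

Lemma mass_Omega v :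
  mass mu (Omega : set T) v = (\int[mu]_(x in Omega) (v x ^+ 2)%:E)%E.
Proof. by apply: eq_integral => x _; rewrite /= mulr1. Qed.

Lemma inVP v : inV Omega gamma v <-> nonlocal_space mu (Omega : set T) k v.
Proof.
have mass0 : (0 <= mass mu (Omega : set T) v)%E by exact: weighted_sqr_ge0.
split=> [[mv vfin]|[mv vM vQ]].
  have [vM vE] : (mass mu (Omega : set T) v < +oo)%E /\
      (energy Omega gamma v < +oo)%E.
    move: vfin; rewrite /normV_sqr -mass_Omega => vfin.
    have E0 : (0 <= energy Omega gamma v)%E.
      apply: integral_ge0 => x _; apply: integral_ge0 => y _.
      by rewrite lee_fin mulr_ge0 ?sqr_ge0.
    split; apply: le_lt_trans vfin; first by rewrite leeDl.
    by rewrite leeDr.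
  by split => //; apply: le_lt_trans vE; exact: jump_energy_le_energy.
split => //; rewrite /normV_sqr -mass_Omega lte_add_pinfty//.
by apply: (le_lt_trans (energy_le_jump_energy mv)); rewrite lte_mul_pinfty.
Qed.
Lemma bilinVE u v : inV Omega gamma u -> inV Omega gamma v ->
  bilinV Omega gamma u v = (jump_form mu k u v)%:E.
Proof.
move=> /inVP Vu /inVP Vv; have [mu' _ _] := Vu; have [mv _ _] := Vv.
have iP := integrable_jump_prod measurable_form_kernel form_kernel_ge0 Vu Vv.
pose part (A : set T) (z : T * T) :=
  (u z.1 - u z.2) * (v z.1 - v z.2) * k0 (z.1, z.2) * (\1_Omega z.1 * \1_A z.2).
have mpart0 : measurable_fun setT
    (fun z : T * T => (u z.1 - u z.2) * (v z.1 - v z.2) * k0 (z.1, z.2)).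
  apply: measurable_funM.
    apply: measurable_funM.
      exact: (@measurable_jump _ T _ u).
    exact: (@measurable_jump _ T _ v).
  by under eq_fun do rewrite -surjective_pairing.
have mpart A : measurable A -> measurable_fun setT (part A).
  move=> mA; apply: measurable_funM => //.
  by apply: measurable_funM; [exact: mindic1|exact: mindic2].
(* The integrand is signed, so Fubini needs integrability of each part: it is dominated by c times
   the integrable total, where c = 2 and c = 1 undo the weights 1/2 and 1. *)
have part_le (A : set T) (c : R) : measurable A -> 0 <= c ->
    (forall z : T * T, k0 z * (\1_Omega z.1 * \1_A z.2) <= c * k z) ->
    M.-integrable setT (EFin \o part A).
  move=> mA c0 kc; have icP := integrableZl measurableT c iP.
  apply: (le_integrable measurableT _ _ icP).
    by apply/measurable_EFinP; exact: mpart.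
  move=> z _ /=; rewrite lee_fin /part -surjective_pairing.
  rewrite -/(jump u z) -/(jump v z) -mulrA [c * _]mulrCA.
  rewrite normrM [leRHS]normrM ler_wpM2l//.
  rewrite !ger0_norm; first exact: kc.
    by rewrite mulr_ge0// form_kernel_ge0.
  by rewrite mulr_ge0// mulr_ge0// indicE.
have iO : M.-integrable setT (EFin \o part Omega).
  apply: (part_le _ 2) => // z; rewrite /k [leRHS]mulrCA ler_wpM2l//.
  rewrite mulrDr mulrA mulfV// mul1r lerDl mulr_ge0// mulr_ge0//.
have iG : M.-integrable setT (EFin \o part Gamma).
  apply: (part_le _ 1) => // z; rewrite mul1r /k ler_wpM2l//.
  by rewrite lerDr mulr_ge0// mulr_ge0.
have iterE A : measurable A -> M.-integrable setT (EFin \o part A) ->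
    (\int[mu]_(x in Omega) \int[mu]_(y in A)
      ((u x - u y) * (v x - v y) * gamma y x)%:E = \int[M]_z (part A z)%:E)%E.
  move=> mA iA.
  rewrite (@iterated_integralE _ _ _ mu (@lebesgue_complete R d) _ _
    (fun x y => (u x - u y) * (v x - v y) * gamma y x)
    (fun x y => (u x - u y) * (v x - v y) * k0 (x, y)))//.
  by apply: filterS k0_ysection => x xk0 _; apply: filterS xk0 => y -> _.
rewrite /bilinV !iterE//.
have i2O := integrableZl measurableT (2^-1 : R) iO.
have -> : ((2^-1)%:E * \int[M]_z (part Omega z)%:E =
    \int[M]_z ((2^-1)%:E * (EFin \o part Omega) z))%E.
  by rewrite (integralZl measurableT iO).
rewrite -(integralD measurableT i2O iG) fineK; last first.
  exact: (integrable_fin_num measurableT iP).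
apply: eq_integral => z _; rewrite /= -EFinM -EFinD; congr EFin.
rewrite /part -surjective_pairing /k /jump.
move: (u z.1 - u z.2) (v z.1 - v z.2) (k0 z) (\1_Omega z.1) (\1_Omega z.2).
by move: (\1_Gamma z.2) => x1 x2 x3 x4 x5 x6; ring.
Qed.

(** * The load functional and the weak problem *)

Hypothesis muOmega : (mu Omega < +oo)%E.
Variables (f g : 'rV[R]_d -> R).
Hypothesis f_L2 : square_integrable Omega f.
Hypothesis g_functional : continuous_functional_condition Omega gamma g.

Definition load v : R :=
  \int[mu]_(x in Omega) (f x * v x) + \int[mu]_(y in Gamma) (g y * v y).

Local Notation V := (nonlocal_space mu (Omega : set T) k).

Let mfO : measurable_fun (Omega : set T) (f : T -> R).
Proof. by case: f_L2. Qed.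

Let f_mass : (mass mu (Omega : set T) f < +oo)%E.
Proof. by rewrite mass_Omega; case: f_L2. Qed.

Let measurable_Omega v : V v -> measurable_fun (Omega : set T) (v : T -> R).
Proof. by move=> [mv _ _]; exact: (measurable_funS measurableT _ mv). Qed.

Lemma integrable_source v : V v ->
  mu.-integrable (Omega : set T) (EFin \o (fun x => f x * v x)).
Proof.
move=> Vv; have [_ vM _] := Vv.
have := integrable_weighted_prod mOmega (measurable_cst _)
  (fun=> fun=> ler01) mfO (measurable_Omega Vv) f_mass vM.
by apply: eq_integrable => // x _ /=; rewrite mulr1.
Qed.

Lemma integrable_flux v : V v ->
  mu.-integrable (Gamma : set T) (EFin \o (fun y => g y * v y)).
Proof. by move=> /inVP Vv; case: g_functional => _ /(_ v Vv). Qed.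

Lemma loadE v : V v ->
  (\int[mu]_(x in Omega) (f x * v x)%:E +
   \int[mu]_(y in Gamma) (g y * v y)%:E)%E = (load v)%:E.
Proof.
move=> Vv; rewrite /load EFinD !fineK//.
  exact: integrable_fin_num (integrable_flux Vv).
exact: integrable_fin_num (integrable_source Vv).
Qed.

Lemma load_comb a u v : V u -> V v ->
  load (fun x => a * u x + v x) = a * load u + load v.
Proof.
move=> Vu Vv; rewrite /load.
have [iu iv] : inV Omega gamma u /\ inV Omega gamma v by split; exact/inVP.
have [_ _ [_ gD _]] := g_functional; rewrite (gD a u v iu iv).
rewrite mulrDr addrACA; congr (_ + _).
rewrite -RintegralZl//; last exact: integrable_source.
rewrite -RintegralD//; last 2 first.
- have := integrableZl mOmega a (integrable_source Vu).
  by apply: eq_integrable => // x _; rewrite /= EFinM.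
- exact: integrable_source.
by apply: eq_Rintegral => x _; ring.
Qed.

Let V0 : V (cst 0). Proof. exact: nonlocal_space_cst. Qed.

Lemma source_bounded v : V v -> (mass mu (Omega : set T) v <= 1)%E ->
  `|\int[mu]_(x in Omega) (f x * v x)| <=
  fine (mass mu (Omega : set T) f) + 1.
Proof.
move=> Vv v1; have [_ vM _] := Vv.
have := normr_weighted_prod_le mOmega (measurable_cst _)
  (fun=> fun=> ler01) mfO (measurable_Omega Vv) f_mass vM.
under eq_Rintegral do rewrite /= mulr1.
move=> /le_trans; apply; rewrite lerD2l -lee_fin.
by rewrite (weighted_sqr_fineK (fun=> fun=> ler01) vM).
Qed.

Lemma flux_bounded : exists B : R, forall v, V v ->
  (mass mu (Omega : set T) v + jump_energy mu k v <= 1)%E ->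
  `|\int[mu]_(y in Gamma) (g y * v y)| <= B.
Proof.
have [_ _ [_ gD gC]] := g_functional.
have V0' : inV Omega gamma (cst 0) by exact/inVP.
have g0 : \int[mu]_(y in Gamma) (g y * cst 0 y) = 0.
  by rewrite /Rintegral integral0_eq// => y _; rewrite /= mulr0.
have [r r0 gr] := gC _ V0' 1 ltr01.
(* The squared norm of a v is at most 4 a^2, one factor 2 coming from [energy_le_jump_energy] and
   one from [weighted_sqr_comb_le]; thus the norm is at most 2 a = 2 r / 3 < r. *)
pose a := r / 3.
have a0 : 0 < a by rewrite divr_gt0.
exists a^-1 => v Vv v1; have /inVP Vv' := Vv; have [mv vM vQ] := Vv.
have Vw : V (fun x => a * v x + cst 0 x).
  exact: (nonlocal_space_comb mOmega measurable_form_kernel form_kernel_ge0).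
have Vw' : inV Omega gamma (fun x => a * v x + cst 0 x) by exact/inVP.
have H := gr _ Vw'; rewrite g0 subr0 (gD a v (cst 0) Vv' V0') g0 addr0 in H.
rewrite normrM gtr0_norm// in H.
rewrite -(ler_pM2l a0) mulfV ?gt_eqF//; apply/ltW/H.
rewrite /normV.
have -> : (fun x => a * v x + cst 0 x - cst 0 x) = (fun x => a * v x + cst 0 x).
  by apply/funext => x; rewrite subr0.
have [mw wM wQ] := Vw.
have a2 : (0 <= (2 * a ^+ 2)%:E)%E by rewrite lee_fin mulr_ge0// sqr_ge0.
have m0 : measurable_fun setT (jump (cst 0 : T -> R)).
  exact: (@measurable_jump _ T).
have m_le : (mass mu (Omega : set T) (fun x => a * v x + cst 0 x)%R <=
    (2 * a ^+ 2)%:E * mass mu (Omega : set T) v)%E.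
  apply: (le_trans (weighted_sqr_comb_le mu mOmega (measurable_cst _)
    (fun=> fun=> ler01) a (measurable_Omega Vv) (measurable_cst _))).
  by rewrite [X in (_ + _ * X)%E]weighted_sqr0// mule0 adde0.
have q_le : (jump_energy mu k (fun x => a * v x + cst 0 x)%R <=
    (2 * a ^+ 2)%:E * jump_energy mu k v)%E.
  rewrite /jump_energy jump_comb.
  apply: (le_trans (weighted_sqr_comb_le M measurableT measurable_form_kernel
    (fun z _ => form_kernel_ge0 z) a (@measurable_jump _ T _ v mv) m0)).
  by rewrite [X in (_ + _ * X)%E]weighted_sqr0 ?mule0 ?adde0// => z;
    rewrite /jump subrr.
have n_le : (normV_sqr Omega gamma (fun x => a * v x + cst 0 x)%R <=
    (4 * a ^+ 2)%:E)%E.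
  rewrite /normV_sqr -mass_Omega.
  have Q0 : (0 <= jump_energy mu k v)%E.
    by apply: weighted_sqr_ge0 => z _; exact: form_kernel_ge0.
  have L0 : (0 <= mass mu (Omega : set T) v)%E by exact: weighted_sqr_ge0.
  apply: (@le_trans _ _ (2%:E * ((2 * a ^+ 2)%:E *
      (mass mu (Omega : set T) v + jump_energy mu k v)))%E); last first.
    apply: (le_trans (lee_wpmul2l _ (lee_wpmul2l a2 v1))) => //.
    by rewrite mule1 -EFinM lee_fin mulrA; lra.
  rewrite [((2 * _)%:E * (_ + _))%E]ge0_muleDr// ge0_muleDr ?mule_ge0//.
  apply: leeD.
    apply: (le_trans m_le); rewrite -[leLHS]mul1e lee_wpmul2r ?mule_ge0//.
    by rewrite lee_fin ler1n.
  by apply: (le_trans (energy_le_jump_energy mw)); rewrite lee_wpmul2l.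
have n_ge0 : (0 <= normV_sqr Omega gamma (fun x => a * v x + cst 0 x)%R)%E.
  rewrite adde_ge0//.
    by apply: integral_ge0 => x _; rewrite lee_fin sqr_ge0.
  apply: integral_ge0 => x _; apply: integral_ge0 => y _.
  by rewrite lee_fin mulr_ge0// sqr_ge0.
apply: (@le_lt_trans _ _ (2 * a)); last by rewrite /a; lra.
have <- : Num.sqrt ((2 * a) ^+ 2) = 2 * a.
  by rewrite sqrtr_sqr ger0_norm// mulr_ge0// ltW.
rewrite ler_wsqrtr//.
rewrite -lee_fin fineK; last first.
  by rewrite ge0_fin_numE// (le_lt_trans n_le)// ltry.
by have -> : (2 * a) ^+ 2 = 4 * a ^+ 2 by ring.
Qed.
Lemma weak_solutionP u : weak_neumann_solution Omega gamma f g u <->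
  V u /\ forall v, V v -> jump_form mu k u v = load v.
Proof.
split=> [[Vu' uB]|[Vu uB]].
  split=> [|v Vv]; first exact/inVP.
  have Vv' : inV Omega gamma v by exact/inVP.
  by apply: EFin_inj; rewrite -(bilinVE Vu' Vv') -(loadE Vv) uB.
have Vu' : inV Omega gamma u by exact/inVP.
split=> // v Vv'; have Vv : V v by exact/inVP.
by rewrite (bilinVE Vu' Vv') (loadE Vv) (uB _ Vv).
Qed.

Hypothesis muOmega_gt0 : (0 < mu Omega)%E.
Hypothesis compatibility :
  (\int[mu]_(x in Omega) (f x)%:E + \int[mu]_(y in Gamma) (g y)%:E = 0)%E.
Hypothesis poincare : exists2 C : R, 0 < C & forall v, inV Omega gamma v ->
  (\int[mu]_(x in Omega) \int[mu]_(y in Omega) ((v x - v y) ^+ 2)%:E <=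
    C%:E * energy Omega gamma v)%E.

(** The constant is the product of 2 / mu Omega from centring, C from the hypothesis and 2 from
    comparing the energy with the form. *)
Let form_poincare : exists2 K : R, 0 <= K & forall v, V v -> exists c,
  (mass mu (Omega : set T) (fun x => v x - c)%R <=
    K%:E * jump_energy mu k v)%E.
Proof.
have [C C0 HC] := poincare.
have m0 : 0 < fine (mu Omega) by rewrite fine_gt0// muOmega_gt0 muOmega.
exists (2 / fine (mu Omega) * (C * 2)).
  by rewrite mulr_ge0 ?divr_ge0 ?mulr_ge0// ltW.
move=> v Vv; have [mv _ _] := Vv.
have [c Hc] := mass_centered_le mOmega muOmega muOmega_gt0 mv.
exists c; apply: (le_trans Hc).
have -> : ((2 / fine (mu Omega) * (C * 2))%:E * jump_energy mu k v =
    (2 / fine (mu Omega))%:E * (C%:E * (2%:E * jump_energy mu k v)))%E.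
  by rewrite !muleA -!EFinM mulrA.
apply: lee_wpmul2l; first by rewrite lee_fin divr_ge0// ltW.
have Vv' : inV Omega gamma v by exact/inVP.
apply: (le_trans (HC v Vv')).
apply: lee_wpmul2l; first by rewrite lee_fin ltW.
exact: energy_le_jump_energy.
Qed.

Let load1 : load (cst 1) = 0.
Proof.
have V1 : V (cst 1) by exact: nonlocal_space_cst.
apply/EFin_inj; rewrite -(loadE V1) -[RHS]compatibility.
by congr (_ + _)%E; apply: eq_integral => x _; rewrite /= mulr1.
Qed.

Lemma weak_solution_exists : exists u, weak_neumann_solution Omega gamma f g u.
Proof.
have [K K0 HK] := form_poincare.
have [B HB] := flux_bounded.
have load_bounded v : V v ->
    (mass mu (Omega : set T) v + jump_energy mu k v <= 1)%E ->
    `|load v| <= fine (mass mu (Omega : set T) f) + 1 + B.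
  move=> Vv v1; apply: (le_trans (ler_normD _ _)); apply: lerD; last exact: HB.
  apply: source_bounded => //; apply: le_trans v1; rewrite leeDl//.
  by apply: weighted_sqr_ge0 => z _; exact: form_kernel_ge0.
have [u Vu uB] := nonlocal_riesz mOmega measurable_form_kernel form_kernel_ge0
  form_kernel_supp form_kernel_exterior muOmega K0 HK load_comb load1
  load_bounded.
by exists u; apply/weak_solutionP.
Qed.

Lemma weak_solution_unique u1 u2 :
  weak_neumann_solution Omega gamma f g u1 ->
  weak_neumann_solution Omega gamma f g u2 ->
  exists c : R, eqV Omega gamma u1 (fun x => u2 x + c).
Proof.
move=> /weak_solutionP[V1 B1] /weak_solutionP[V2 B2].
have [K K0 HK] := form_poincare.
have Vw : V (fun x => -1 * u2 x + u1 x).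
  exact: (nonlocal_space_comb mOmega measurable_form_kernel form_kernel_ge0).
have w0 : jump_energy mu k (fun x => -1 * u2 x + u1 x) = 0%E.
  rewrite -(jump_form_energy form_kernel_ge0 Vw).
  rewrite (jump_form_comb measurable_form_kernel form_kernel_ge0 _ V2 V1 Vw).
  by rewrite (B1 _ Vw) (B2 _ Vw) mulN1r addNr.
have [c Hc] := jump_energy_eq0_cst mOmega measurable_form_kernel
  form_kernel_ge0 form_kernel_supp form_kernel_exterior muOmega HK Vw w0.
exists c; apply: filterS Hc => x wx /wx <-.
by rewrite mulN1r addrA subrr add0r.
Qed.

End neumann_form.

(** This settles the case mu Omega = 0, where centring cannot divide by mu Omega: the integral
    defining Gamma runs over a null set, so Gamma is empty and both sides of the weak equation
    vanish. *)
Lemma weak_solution_null (R : realType) (d : nat) (Omega : set 'rV[R]_d)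
    (gamma : 'rV[R]_d -> 'rV[R]_d -> R) (f g u : 'rV[R]_d -> R) :
  measurable (Omega : set (lebesgue_space R d)) ->
  lebesgue_rV R d Omega = 0%E -> rV_measurable_fun setT u ->
  weak_neumann_solution Omega gamma f g u.
Proof.
move=> mO O0 mu_; have int0 h : (\int[lebesgue_rV R d]_(x in Omega) h x = 0)%E.
  exact: (integral_null_set (@lebesgue_complete R d)).
have G0 : interaction_domain Omega gamma = set0.
  by rewrite -subset0 => y [_]; rewrite int0 ltxx.
split=> [|v _].
  by split => //; rewrite /normV_sqr /energy !int0 adde0 ltry.
by rewrite /bilinV G0 !int0 !integral_set0 mule0.
Qed.

Theorem theorem3p7 (R : realType) (d : nat) (Omega : set 'rV[R]_d)
    (f : 'rV[R]_d -> R) (gamma : 'rV[R]_d -> 'rV[R]_d -> R) (g : 'rV[R]_d -> R)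
    (Omega_bounded : bounded_set Omega)
    (Omega_nonempty : Omega !=set0)
    (Omega_open : open Omega)
    (f_L2 : square_integrable Omega f)
    (gamma_ge0 : forall x y, 0 <= gamma x y)
    (gamma_measurable : jointly_measurable gamma)
    (gamma_symmetric : symmetric_kernel gamma)
    (g_functional : continuous_functional_condition Omega gamma g)
    (compatibility :
      (\int[lebesgue_rV R d]_(x in Omega) (f x)%:E
       + \int[lebesgue_rV R d]_(y in interaction_domain Omega gamma) (g y)%:E = 0)%E)
    (poincare : exists2 C : R, 0 < C & forall v, inV Omega gamma v ->
      (\int[lebesgue_rV R d]_(x in Omega) \int[lebesgue_rV R d]_(y in Omega)
         ((v x - v y) ^+ 2)%:E <= C%:E * energy Omega gamma v)%E) :
  (exists u, weak_neumann_solution Omega gamma f g u) /\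
  (forall u1 u2, weak_neumann_solution Omega gamma f g u1 ->
     weak_neumann_solution Omega gamma f g u2 ->
     exists c : R, eqV Omega gamma u1 (fun x => u2 x + c)).
Proof.
have mO := measurable_open Omega_open.
have [muOm0|muOm_neq0] := eqVneq (lebesgue_rV R d Omega) 0%E.
  split; first by exists (cst 0);
    apply: weak_solution_null => //; exact: measurable_cst.
  move=> u1 u2 _ _; exists 0; exists Omega; split => // x /= nx.
  apply: contrapT => nO; apply: nx => -[//|[_]].
  by rewrite (integral_null_set (@lebesgue_complete R d))// ltxx.
have muOm_gt0 : (0 < lebesgue_rV R d Omega)%E.
  by rewrite lt0e muOm_neq0 measure_ge0.
have muOm_fin : (lebesgue_rV R d Omega < +oo)%E.
  have [m Om] := bounded_sub_cube Omega_bounded.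
  apply: le_lt_trans (ltry (box_vol (cube R d m))).
  exact: le_trans (le_lebesgue_outer Om) (lebesgue_outer_box_le _).
have [k [mk k_ge0 kx ky]] :=
  product_measurable_version gamma_ge0 gamma_measurable.
split.
  exact: (weak_solution_exists mO gamma_ge0 mk k_ge0 kx ky).
move=> u1 u2.
exact: (weak_solution_unique mO gamma_ge0 mk k_ge0 kx ky).
Qed.
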